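(* Let $R$ be a domain and $t\in R$ a prime element, such that: (A1) $R_t\cap R_{tR}=R$ (intersection inside $\operatorname{Frac}R$); (A2) $R$ is weakly $5$-fold stable and the natural map $K_2^M(R)\to K_2(R)$ is an isomorphism; (A3) the group $(1+tR)^\times$ is generated by those of its elements which are of the form $1+tw$ with $w\in R^\times$. Then there is a short exact sequence $$0\to K_2^M(R)\to K_2^M(R_t)\xrightarrow{\ \overline{c}\ }R^\times/(1+tR)^\times\to0,$$ where the first map is the natural one and $\overline c(\{f,g\})$ is the class of the tame symbol $c(f,g)$ in $R^\times/(1+tR)^\times$ (i.e. $c(f,g)$ mod $tR$) for $f,g\in R_t^\times$.
   Context: All rings are commutative, unital and Noetherian. A prime element of a ring is an element generating a non-zero, proper prime ideal. $R_t=R[t^{-1}]$, and $R_{tR}$ is the localisation of $R$ at the prime ideal $tR$, a discrete valuation ring; $\nu=\nu_t$ denotes the associated $t$-adic valuation on $\operatorname{Frac}R$. $(1+tR)^\times:=(1+tR)\cap R^\times$, a subgroup of $R^\times$. Assumption (A1) implies that every $f\in R_t^\times$ can be written as $f=ut^n$ for unique $u\in R^\times$, $n\in\mathbb Z$ (namely $n=\nu(f)$). For $f=ut^n,\ g=vt^m\in R_t^\times$ so written, the tame symbol is $$c(f,g):=(-1)^{\nu(f)\nu(g)}f^{\nu(g)}g^{-\nu(f)}=(-1)^{nm}u^mv^{-n}\in R^\times.$$ A ring $R$ is weakly $k$-fold stable ($k\ge1$) if whenever $b_1,\dots,b_{k-1}\in R$ are given, there exists $u\in R^\times$ such that $1+ub_1,\dots,1+ub_{k-1}$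 are units. $K_2(R)=\operatorname{Ker}(St(R)\to E(R))$, where $St(R)$ is the (infinite) Steinberg group with standard generators $x_{ij}(a)$ and $E(R)$ is the group of infinite elementary matrices; it is written additively. For $a\in R^\times$ put $w_{ij}(a)=x_{ij}(a)x_{ji}(-a^{-1})x_{ij}(a)$ and $h_{ij}(a)=w_{ij}(a)w_{ij}(-1)$. For $a,b\in R^\times$ the Steinberg symbol is $\{a,b\}:=[h_{12}(a),h_{13}(b)]\in K_2(R)$. $K_2^M(R)$ is the abelian group generated by symbols $\{a,b\}$, $a,b\in R^\times$, subject to bilinearity, $\{a,bc\}=\{a,b\}+\{a,c\}$ and $\{ac,b\}=\{a,b\}+\{c,b\}$, and the Steinberg relation $\{a,1-a\}=0$ whenever $a,1-a\in R^\times$. The natural map $K_2^M(R)\to K_2(R)$ sends $\{a,b\}$ to the Steinberg symbol $\{a,b\}$. *)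

(* Defs.v *)
From HB Require Import structures.
From mathcomp Require Import all_boot all_order all_algebra.
From mathcomp Require Import mathcomp_extra boolp classical_sets functions.
From mathcomp Require Import cardinality fsbigop ring.

Set Implicit Arguments.
Unset Strict Implicit.
Unset Printing Implicit Defensive.

Import GRing.Theory.
Local Open Scope quotient_scope.
Local Open Scope ring_scope.

Notation "x %:F" := (@FracField.tofrac _ x) : ring_scope.

Section Presentation.
Variable X : choiceType.

(* The letter (x, true) stands for x, and (x, false) for its inverse. *)
Definition word := seq (X * bool).

Definition word_inv (w : word) : word := rev [seq (p.1, ~~ p.2) | p <- w].

Variable rel : word -> word -> Prop.

Inductive word_cong : word -> word -> Prop :=
| WCrefl u : word_cong u u
| WCsym u v : word_cong u v -> word_cong v u
| WCtrans v u w : word_cong u v -> word_cong v w -> word_cong u w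
| WCcat u u' v v' :
    word_cong u u' -> word_cong v v' -> word_cong (u ++ v) (u' ++ v')
| WCcancel x b : word_cong [:: (x, b); (x, ~~ b)] [::]
| WCrel u v : rel u v -> word_cong u v.

Definition word_eqv (u v : word) : bool := `[< word_cong u v >].

Lemma word_eqv_refl : reflexive word_eqv.
Proof. by move=> u; apply/asboolP; exact: WCrefl. Qed.

Lemma word_eqv_sym : symmetric word_eqv.
Proof.
by move=> u v; apply/asboolP/asboolP => ?; exact: WCsym.
Qed.

Lemma word_eqv_trans : transitive word_eqv.
Proof.
by move=> v u w /asboolP uv /asboolP vw; apply/asboolP; exact: (WCtrans uv vw).
Qed.

Canonical word_eqv_equiv :=
  EquivRel word_eqv word_eqv_refl word_eqv_sym word_eqv_trans.

Definition presented := {eq_quot word_eqv}.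
HB.instance Definition _ : EqQuotient _ word_eqv presented :=
  EqQuotient.on presented.
HB.instance Definition _ := Choice.on presented.

Lemma presented_eqP (u v : word) :
  word_cong u v <-> \pi_presented u = \pi_presented v.
Proof.
by split=> [uv|/eqmodP/asboolP//]; apply/eqmodP/asboolP.
Qed.

Lemma word_cong_mulV w : word_cong (w ++ word_inv w) [::].
Proof.
elim: w => [|[x b] w IH]; first exact: WCrefl.
rewrite /word_inv /= rev_cons -cats1 -cat_cons catA -(cat1s _ w) -catA.
have h := WCcat (WCcat (WCrefl [:: (x, b)]) IH) (WCrefl [:: (x, ~~ b)]).
rewrite -!catA in h *; apply: WCtrans h _; exact: WCcancel.
Qed.

Lemma word_invK : involutive word_inv.
Proof.
move=> w; rewrite /word_inv map_rev revK -map_comp -[RHS]map_id.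
by apply: eq_map => -[x b] /=; rewrite negbK.
Qed.

Lemma word_cong_mulVw w : word_cong (word_inv w ++ w) [::].
Proof. by have := word_cong_mulV (word_inv w); rewrite word_invK. Qed.

Lemma word_cong_inv u v : word_cong u v -> word_cong (word_inv u) (word_inv v).
Proof.
move=> uv; apply: (@WCtrans (word_inv u ++ (v ++ word_inv v))).
  rewrite -[X in word_cong X _]cats0; apply: WCcat; first exact: WCrefl.
  exact/WCsym/word_cong_mulV.
apply: (@WCtrans ((word_inv u ++ u) ++ word_inv v)).
  rewrite catA; apply: WCcat; last exact: WCrefl.
  by apply: WCcat; [exact: WCrefl | exact: WCsym].
rewrite -[X in word_cong _ X]cat0s; apply: WCcat; last exact: WCrefl.
exact: word_cong_mulVw.
Qed.

Definition presented_one : presented := lift_cst presented ([::] : word).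
Canonical pi_presented_one_morph := PiConst presented_one.
Definition presented_mul := lift_op2 presented (fun u v : word => u ++ v).
Definition presented_inv := lift_op1 presented word_inv.

Lemma pi_presented_mul :
  {morph \pi_presented : u v / (u ++ v : word) >-> presented_mul u v}.
Proof.
move=> u v; unlock presented_mul; apply/presented_eqP.
by apply: WCcat; apply/presented_eqP; rewrite reprK.
Qed.
Canonical pi_presented_mul_morph := PiMorph2 pi_presented_mul.

Lemma pi_presented_inv :
  {morph \pi_presented : u / word_inv u >-> presented_inv u}.
Proof.
move=> u; unlock presented_inv; apply/presented_eqP.
by apply: word_cong_inv; apply/presented_eqP; rewrite reprK.
Qed.
Canonical pi_presented_inv_morph := PiMorph1 pi_presented_inv.

Lemma pi_presented_one : \pi_presented [::] = presented_one.
Proof. by rewrite piE. Qed.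

Lemma presented_mulA : associative presented_mul.
Proof.
by elim/quotW=> u; elim/quotW=> v; elim/quotW=> w; rewrite !piE catA.
Qed.
Lemma presented_mul1 : left_id presented_one presented_mul.
Proof. by elim/quotW=> u; rewrite !piE. Qed.
Lemma presented_mulr1 : right_id presented_one presented_mul.
Proof. by elim/quotW=> u; rewrite !piE cats0. Qed.
Lemma presented_mulV : left_inverse presented_one presented_inv presented_mul.
Proof.
elim/quotW=> u; rewrite !piE; apply/presented_eqP; exact: word_cong_mulVw.
Qed.
Lemma presented_mulrV : right_inverse presented_one presented_inv presented_mul.
Proof.
elim/quotW=> u; rewrite !piE; apply/presented_eqP; exact: word_cong_mulV.
Qed.

HB.instance Definition _ := isGroup.Build presented presented_mulA
  presented_mul1 presented_mulr1 presented_mulV presented_mulrV.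

Definition pgen (x : X) : presented := \pi [:: (x, true)].

(* The universal property. The target is only a monoid, so the images g x of  *)
(* the inverses of the generators are supplied along with the images f x.     *)
Section Lift.
Variables (M : monoidType) (f g : X -> M).

Definition word_eval (w : word) : M :=
  (\prod_(p <- w) (if p.2 then f p.1 else g p.1))%g.

Definition presented_lift (x : presented) : M := word_eval (repr x).

Hypothesis fg : forall x, (f x * g x = 1)%g.
Hypothesis gf : forall x, (g x * f x = 1)%g.
Hypothesis f_rel : forall u v, rel u v -> word_eval u = word_eval v.

Lemma word_eval_cong u v : word_cong u v -> word_eval u = word_eval v.
Proof.
elim=> {u v} // [v u w _ -> _ -> //|u u' v v' _ e1 _ e2|x [] /=].
- by rewrite /word_eval !big_cat /= -!/(word_eval _) e1 e2.
- by rewrite /word_eval !big_cons !big_nil mulg1 fg.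
- by rewrite /word_eval !big_cons !big_nil mulg1 gf.
Qed.

Lemma presented_lift_pi w : presented_lift (\pi w) = word_eval w.
Proof. by apply: word_eval_cong; apply/presented_eqP; rewrite reprK. Qed.

Lemma presented_lift_gen x : presented_lift (pgen x) = f x.
Proof.
by rewrite presented_lift_pi /word_eval big_cons big_nil mulg1.
Qed.

Lemma presented_lift1 : presented_lift 1%g = 1%g.
Proof.
by rewrite -[1%g in LHS]pi_presented_one presented_lift_pi /word_eval big_nil.
Qed.

Lemma presented_liftM : {morph presented_lift : x y / (x * y)%g}.
Proof.
elim/quotW=> u; elim/quotW=> v.
transitivity (presented_lift (\pi_presented (u ++ v))).
  by rewrite pi_presented_mul.
rewrite !presented_lift_pi.
by rewrite /word_eval big_cat.
Qed.
End Lift.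

End Presentation.

Arguments pgen {X rel} x.

Section Units.
Variable R : comUnitRingType.

Record units := Units { uval : R; uvalP : uval \is a GRing.unit }.
HB.instance Definition _ := [isSub for uval].
HB.instance Definition _ := [Choice of units by <:].

Definition units_one := Units (unitr1 R).
Definition units_mul (u v : units) : units :=
  @Units (uval u * uval v)
    (eq_trans (unitrM _ _) (introT andP (conj (uvalP u) (uvalP v)))).
Definition units_inv (u : units) : units :=
  @Units (uval u)^-1 (eq_trans (unitrV _) (uvalP u)).

Lemma units_mulA : associative units_mul.
Proof. by move=> u v w; apply/val_inj; rewrite /= mulrA. Qed.
Lemma units_mul1 : left_id units_one units_mul.
Proof. by move=> u; apply/val_inj; rewrite /= mul1r. Qed.
Lemma units_mulr1 : right_id units_one units_mul.
Proof. by move=> u; apply/val_inj; rewrite /= mulr1. Qed.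
Lemma units_mulV : left_inverse units_one units_inv units_mul.
Proof. by move=> u; apply/val_inj; rewrite /= mulVr ?uvalP. Qed.
Lemma units_mulrV : right_inverse units_one units_inv units_mul.
Proof. by move=> u; apply/val_inj; rewrite /= mulrV ?uvalP. Qed.

HB.instance Definition _ := isGroup.Build units
  units_mulA units_mul1 units_mulr1 units_mulV units_mulrV.

Lemma units_mulC (u v : units) : (u * v = v * u)%g.
Proof. by apply/val_inj; rewrite /= mulrC. Qed.

End Units.

Definition units_map (R S : comUnitRingType) (phi : {rmorphism R -> S})
  (u : units R) : units S := Units (rmorph_unit phi (uvalP u)).

Section K2M.
Variable R : comUnitRingType.

Inductive K2M_rel :
    word (units R * units R)%type -> word (units R * units R)%type -> Prop :=
| K2M_mulr a b c :
    K2M_rel [:: ((a, b * c)%g, true)] [:: ((a, b), true); ((a, c), true)]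
| K2M_mull a b c :
    K2M_rel [:: ((a * c, b)%g, true)] [:: ((a, b), true); ((c, b), true)]
| K2M_steinberg (a b : units R) : uval b = 1 - uval a ->
    K2M_rel [:: ((a, b), true)] [::]
| K2M_comm p q :
    K2M_rel [:: (p, true); (q, true)] [:: (q, true); (p, true)].

Definition K2M := presented K2M_rel.

Lemma K2M_mulC : commutative (fun x y : presented K2M_rel => (x * y)%g).
Proof.
elim/quotW=> u; elim/quotW=> v.
rewrite -[LHS]pi_presented_mul -[RHS]pi_presented_mul; apply/presented_eqP.
have letter_comm p b q c : word_cong K2M_rel [:: (p, b); (q, c)] [:: (q, c); (p, b)].
  have swapV (x : (units R * units R) * bool) (q' : units R * units R) (d : bool) :
      word_cong K2M_rel [:: x; (q', d)] [:: (q', d); x] ->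
      word_cong K2M_rel [:: x; (q', ~~ d)] [:: (q', ~~ d); x].
    move=> h.
    apply: (@WCtrans _ _ [:: (q', ~~ d); (q', d); x; (q', ~~ d)]).
      rewrite -(cat0s [:: x; _]) -(cat1s _ (_ :: [:: x; _])).
      rewrite -[X in word_cong _ _ X]/([:: (q', ~~ d); (q', d)] ++ [:: x; (q', ~~ d)]).
      apply: WCcat; last exact: WCrefl.
      by apply: WCsym; have := WCcancel K2M_rel q' (~~ d); rewrite negbK.
    apply: (@WCtrans _ _ [:: (q', ~~ d); x; (q', d); (q', ~~ d)]).
      apply: (@WCcat _ _ [:: (q', ~~ d)] [:: (q', ~~ d)]); first exact: WCrefl.
      apply: (@WCcat _ _ [:: (q', d); x] [:: x; (q', d)]); last exact: WCrefl.
      exact: WCsym.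
    apply: (@WCcat _ _ [:: (q', ~~ d); x] [:: (q', ~~ d); x] _ [::]).
      exact: WCrefl.
    exact: WCcancel.
  have htt := WCrel (K2M_comm p q).
  have htf := swapV _ _ _ htt.
  have hft := WCsym (swapV _ _ _ (WCsym htt)).
  have hff := swapV _ _ _ hft.
  by case: b; case: c.
have cons_comm x w : word_cong K2M_rel (x :: w) (w ++ [:: x]).
  elim: w => [|y w IH]; first exact: WCrefl.
  apply: (@WCtrans _ _ (y :: x :: w)).
    apply: (@WCcat _ _ [:: x; y] [:: y; x]); last exact: WCrefl.
    by case: x {IH} => p b; case: y => q c; exact: letter_comm.
  exact: (@WCcat _ _ [:: y] [:: y] _ _ (WCrefl _ _) IH).
elim: u => [|x u IH] /=; first by rewrite cats0; exact: WCrefl.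
apply: WCtrans (@WCcat _ _ [:: x] [:: x] _ _ (WCrefl _ _) IH) _.
rewrite -[in X in word_cong _ _ X](cat1s x) cat1s -cat_cons catA.
exact: WCcat (cons_comm _ _) (WCrefl _ _).
Qed.

(* The group law of K_2^M is written additively. *)
HB.instance Definition _ := Choice.on K2M.
HB.instance Definition _ := @GRing.isZmodule.Build K2M
  1%g (fun x : presented K2M_rel => x^-1%g)
  (fun x y : presented K2M_rel => (x * y)%g)
  (@mulgA _) K2M_mulC (@mul1g _) (@mulVg _).

Definition symb (a b : units R) : K2M := pgen (a, b).

End K2M.

Section K2M_theory.
Variable R : comUnitRingType.

Lemma symbMr (a b c : units R) : symb a (b * c)%g = symb a b + symb a c.
Proof.
rewrite -[RHS]pi_presented_mul; apply/presented_eqP/WCrel; exact: K2M_mulr.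
Qed.

Lemma symbMl (a b c : units R) : symb (a * c)%g b = symb a b + symb c b.
Proof.
rewrite -[RHS]pi_presented_mul; apply/presented_eqP/WCrel; exact: K2M_mull.
Qed.

Lemma symb_steinberg (a b : units R) : uval b = 1 - uval a -> symb a b = 0.
Proof.
move=> hab; rewrite -[RHS](pi_presented_one (@K2M_rel R)).
apply/presented_eqP/WCrel; exact: K2M_steinberg.
Qed.

End K2M_theory.

Section K2M_map.
Variables (R S : comUnitRingType) (phi : {rmorphism R -> S}).

Definition K2M_map_gen (p : units R * units R) : K2M S :=
  symb (units_map phi p.1) (units_map phi p.2).

Definition K2M_map (x : K2M R) : K2M S :=
  @presented_lift _ _ (presented (@K2M_rel S)) K2M_map_gen
    (fun p => - K2M_map_gen p) x.

Lemma K2M_map_rel u v : K2M_rel u v ->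
  @word_eval _ (presented (@K2M_rel S)) K2M_map_gen
    (fun p => - K2M_map_gen p) u =
  word_eval K2M_map_gen (fun p => - K2M_map_gen p) v.
Proof.
have um (a b : units R) :
    units_map phi (a * b)%g = (units_map phi a * units_map phi b)%g.
  by apply/val_inj; rewrite /= rmorphM.
case=> [a b c|a b c|a b hab|p q];
  rewrite /word_eval !big_cons !big_nil ?mulg1 /=.
- by rewrite /K2M_map_gen /= um; exact: symbMr.
- by rewrite /K2M_map_gen /= um; exact: symbMl.
- by apply: symb_steinberg; rewrite /= hab rmorphB rmorph1.
- exact: K2M_mulC.
Qed.

Lemma K2M_map_is_zmod_morphism : zmod_morphism K2M_map.
Proof.
have mapD x y : K2M_map (x + y) = K2M_map x + K2M_map y.
  apply: presented_liftM => [p|p|]; last exact: K2M_map_rel.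
    exact: (@mulgV (presented (@K2M_rel S))).
  exact: (@mulVg (presented (@K2M_rel S))).
by move=> x y; apply/eqP; rewrite eq_sym subr_eq -mapD subrK.
Qed.
HB.instance Definition _ :=
  GRing.isZmodMorphism.Build (K2M R) (K2M S) K2M_map K2M_map_is_zmod_morphism.

Lemma K2M_map_symb a b :
  K2M_map (symb a b) = symb (units_map phi a) (units_map phi b).
Proof.
apply: presented_lift_gen => [p|p|]; last exact: K2M_map_rel.
  exact: (@mulgV (presented (@K2M_rel S))).
exact: (@mulVg (presented (@K2M_rel S))).
Qed.

End K2M_map.

Section InfiniteMatrices.
Variable R : comUnitRingType.

Definition finitary (A : nat -> nat -> R) : Prop :=
  exists n, forall i j, (n <= maxn i j)%N -> A i j = (i == j)%:R.

(* Infinite matrices equal to the identity outside a finite square block. *)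
Record finmx :=
  Finmx { finmx_fun :> nat -> nat -> R; finmxP : `[< finitary finmx_fun >] }.
HB.instance Definition _ := [isSub for finmx_fun].
HB.instance Definition _ := [Choice of finmx by <:].

Definition infmx_mul (A B : nat -> nat -> R) : nat -> nat -> R :=
  fun i k => \sum_(j \in [set: nat]) A i j * B j k.

Lemma infmx_mulE (A B : nat -> nat -> R) n N i k :
    (forall i j, (n <= maxn i j)%N -> A i j = (i == j)%:R) ->
    (n <= N)%N -> (i < N)%N ->
  infmx_mul A B i k = \sum_(j < N) A i j * B j k.
Proof.
move=> hA nN iN; rewrite /infmx_mul (fsbig_ord _ _ (fun j => A i j * B j k)).
apply/esym/fsbig_widen => // j [_ /= /negP]; rewrite -leqNgt => Nj.
rewrite hA; last by rewrite (leq_trans nN) // (leq_trans Nj) ?leq_maxr.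
by rewrite (ltn_eqF (leq_trans iN Nj)) mul0r.
Qed.

Lemma finitary1 : finitary (fun i j => (i == j)%:R).
Proof. by exists 0%N. Qed.

Lemma finitaryM A B : finitary A -> finitary B -> finitary (infmx_mul A B).
Proof.
move=> [n hA] [m hB]; exists (maxn n m) => i k.
set N := (maxn (maxn n m) (maxn i k)).+1 => le_nm.
have nN : (n <= N)%N by rewrite ltnW // ltnS !leq_max leqnn.
have iN : (i < N)%N by rewrite ltnS !leq_max leqnn !orbT.
have kN : (k < N)%N by rewrite ltnS !leq_max leqnn !orbT.
rewrite (infmx_mulE _ _ hA nN iN).
move: le_nm; rewrite geq_max => /andP[le_n le_m].
have [le_mk|lt_km] := leqP m k.
  rewrite (bigD1 (Ordinal kN)) //= big1 ?addr0; last first.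
    move=> j jk; rewrite hB ?leq_max ?le_mk ?orbT //.
    by rewrite [_ == k](negbTE jk) mulr0.
  by rewrite hB ?leq_max ?le_mk ?orbT // eqxx mulr1 hA.
have le_mi : (m <= i)%N by move: le_m; rewrite leq_max [(m <= k)%N]leqNgt lt_km orbF.
have [le_ni|lt_in] := leqP n i; last first.
  have le_nk : (n <= k)%N by move: le_n; rewrite leq_max [(n <= i)%N]leqNgt lt_in.
  by have := leq_trans (leq_trans (leq_trans lt_km le_mi) (ltnW lt_in)) le_nk;
    rewrite ltnn.
rewrite (bigD1 (Ordinal iN)) //= big1 ?addr0; last first.
  move=> j ji; rewrite hA ?leq_max ?le_ni //.
  by rewrite eq_sym [_ == i](negbTE ji) mul0r.
by rewrite hA ?leq_max ?le_ni // eqxx mul1r hB.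
Qed.

Definition finmx_one : finmx := Finmx (introT (asboolP _) finitary1).
Definition finmx_mul (A B : finmx) : finmx :=
  Finmx (introT (asboolP _)
    (finitaryM (elimT (asboolP _) (finmxP A)) (elimT (asboolP _) (finmxP B)))).

Lemma finmx_eqP (A B : finmx) : A =2 B -> A = B.
Proof.
by move=> AB; apply/val_inj/funext => i; apply/funext => j; exact: AB.
Qed.

Lemma finmx_mulA : associative finmx_mul.
Proof.
move=> A B C; apply: finmx_eqP => i l /=.
have /asboolP[n hA] := finmxP A; have /asboolP[m hB] := finmxP B.
have /asboolP[p hAB] := finmxP (finmx_mul A B).
set N := (maxn (maxn n m) (maxn p i)).+1.
have nN : (n <= N)%N by rewrite ltnW // ltnS !leq_max leqnn.
have mN : (m <= N)%N by rewrite ltnW // ltnS !leq_max leqnn ?orbT.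
have pN : (p <= N)%N by rewrite ltnW // ltnS !leq_max leqnn ?orbT.
have iN : (i < N)%N by rewrite ltnS !leq_max leqnn ?orbT.
rewrite (infmx_mulE _ _ hA nN iN) (infmx_mulE _ _ hAB pN iN).
under eq_bigr => j _ do rewrite (infmx_mulE _ _ hB mN (ltn_ord j)) mulr_sumr.
rewrite exchange_big /=; apply: eq_bigr => k _.
rewrite (infmx_mulE _ _ hA nN iN) mulr_suml.
by apply: eq_bigr => j _; rewrite mulrA.
Qed.

Lemma finmx_mul1 : left_id finmx_one finmx_mul.
Proof.
move=> A; apply: finmx_eqP => i k /=.
have h1 : forall i j, (0 <= maxn i j)%N -> (i == j)%:R = (i == j)%:R :> R by [].
rewrite (infmx_mulE _ _ h1 (leq0n i.+1)) // (bigD1 ord_max) //= eqxx mul1r.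
rewrite big1 ?addr0 // => j ji.
by rewrite eq_sym [_ == i](negbTE ji) mul0r.
Qed.

Lemma finmx_mulr1 : right_id finmx_one finmx_mul.
Proof.
move=> A; apply: finmx_eqP => i k /=.
have /asboolP[n hA] := finmxP A.
set N := (maxn n (maxn i k)).+1.
have nN : (n <= N)%N by rewrite ltnW // ltnS !leq_max leqnn.
have iN : (i < N)%N by rewrite ltnS !leq_max leqnn !orbT.
have kN : (k < N)%N by rewrite ltnS !leq_max leqnn !orbT.
rewrite (infmx_mulE _ _ hA nN iN) (bigD1 (Ordinal kN)) //= eqxx mulr1.
by rewrite big1 ?addr0 // => j jk; rewrite [_ == k](negbTE jk) mulr0.
Qed.

HB.instance Definition _ :=
  isMonoid.Build finmx finmx_mulA finmx_mul1 finmx_mulr1.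

Definition elem_fun (i j : nat) (a : R) (k l : nat) : R :=
  (k == l)%:R + a * ((k == i) && (l == j))%:R.

Lemma elem_finitary i j a : i != j -> finitary (elem_fun i j a).
Proof.
move=> ij; exists (maxn i j).+1 => k l; rewrite /elem_fun => h.
case: (eqVneq k i) h => [->|_] /=; last by rewrite mulr0 addr0.
case: (eqVneq l j) => [->|_] /=; last by rewrite mulr0 addr0.
by rewrite ltnn.
Qed.

(* The elementary matrix e_ij(a). *)
Definition elem (i j : nat) (ij : i != j) (a : R) : finmx :=
  Finmx (introT (asboolP _) (elem_finitary a ij)).

Lemma elem_mulE i j (ij : i != j) a (A : finmx) k l :
  (elem ij a * A)%g k l = A k l + (k == i)%:R * (a * A j l).
Proof.
rewrite -[LHS]/(infmx_mul (elem_fun i j a) A k l).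
have /asboolP[n hE] := finmxP (elem ij a).
set N := (maxn n (maxn k j)).+1.
have nN : (n <= N)%N by rewrite ltnW // ltnS !leq_max leqnn.
have kN : (k < N)%N by rewrite ltnS !leq_max leqnn !orbT.
have jN : (j < N)%N by rewrite ltnS !leq_max leqnn !orbT.
rewrite (infmx_mulE _ _ hE nN kN) /elem_fun.
under eq_bigr => m _ do rewrite mulrDl.
rewrite big_split /=; congr (_ + _).
  rewrite (bigD1 (Ordinal kN)) //= eqxx mul1r big1 ?addr0 // => m mk.
  by rewrite eq_sym [_ == k](negbTE mk) mul0r.
rewrite (bigD1 (Ordinal jN)) //= eqxx andbT big1 ?addr0 => [|m mj].
  by rewrite mulrAC mulrA mulrC mulrA.
by rewrite [_ == j](negbTE mj) andbF mulr0 mul0r.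
Qed.

Lemma elemD i j (ij : i != j) a b : (elem ij a * elem ij b)%g = elem ij (a + b).
Proof.
rewrite -[elem ij b]mulg1 -[RHS]mulg1; apply: finmx_eqP => k l.
rewrite !elem_mulE [j == i]eq_sym (negbTE ij) mul0r addr0 -addrA -mulrDr.
by rewrite mulrDl [X in _ * X]addrC.
Qed.

Lemma elem0 i j (ij : i != j) : elem ij 0 = 1%g.
Proof.
by rewrite -[LHS]mulg1; apply: finmx_eqP => k l; rewrite elem_mulE mul0r mulr0 addr0.
Qed.

Lemma elemNr i j (ij : i != j) a : (elem ij a * elem ij (- a))%g = 1%g.
Proof. by rewrite elemD subrr elem0. Qed.

Lemma elemNl i j (ij : i != j) a : (elem ij (- a) * elem ij a)%g = 1%g.
Proof. by rewrite elemD addNr elem0. Qed.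

End InfiniteMatrices.

Section Steinberg.
Variable R : comUnitRingType.

Definition St_gen : Type := {p : nat * nat | p.1 != p.2} * R.
HB.instance Definition _ := Choice.on St_gen.

Definition st_gen (i j : nat) (ij : i != j) (a : R) : St_gen :=
  (exist (fun p : nat * nat => p.1 != p.2) (i, j) ij, a).

Inductive St_rel : word St_gen -> word St_gen -> Prop :=
| St_add i j (ij : i != j) a b :
    St_rel [:: (st_gen ij a, true); (st_gen ij b, true)]
           [:: (st_gen ij (a + b), true)]
| St_comm i j k (ij : i != j) (jk : j != k) (ik : i != k) a b :
    St_rel [:: (st_gen ij a, true);  (st_gen jk b, true);
               (st_gen ij a, false); (st_gen jk b, false)]
           [:: (st_gen ik (a * b), true)]
| St_comm1 i j k l (ij : i != j) (kl : k != l) a b : j != k -> i != l ->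
    St_rel [:: (st_gen ij a, true);  (st_gen kl b, true);
               (st_gen ij a, false); (st_gen kl b, false)]
           [::].

Definition St := presented St_rel.
HB.instance Definition _ := Group.on St.

Definition stx (i j : nat) (ij : i != j) (a : R) : St := pgen (st_gen ij a).

(* The homomorphism x_ij(a) |-> e_ij(a). Its image is E(R), so that its       *)
(* kernel is the kernel of St(R) -> E(R).                                     *)
Definition St_to_E : St -> finmx R :=
  presented_lift (fun g : St_gen => elem (valP g.1) g.2)
                 (fun g : St_gen => elem (valP g.1) (- g.2)).

Lemma St_to_E_rel u v : St_rel u v ->
  word_eval (fun g : St_gen => elem (valP g.1) g.2)
            (fun g : St_gen => elem (valP g.1) (- g.2)) u =
  word_eval (fun g : St_gen => elem (valP g.1) g.2)
            (fun g : St_gen => elem (valP g.1) (- g.2)) v.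
Proof.
case=> [i j ij a b|i j k ij jk ik a b|i j k l ij kl a b jk il];
  rewrite /word_eval !big_cons !big_nil /=.
- by rewrite !mulg1 elemD.
- apply: finmx_eqP => p q; rewrite !elem_mulE /= !eqxx.
  rewrite ?[j == i]eq_sym ?[k == i]eq_sym ?[k == j]eq_sym.
  rewrite ?(negbTE ij) ?(negbTE jk) ?(negbTE ik).
  by rewrite /=; ring.
- apply: finmx_eqP => p q; rewrite !elem_mulE /=.
  rewrite ?[j == i]eq_sym ?[l == i]eq_sym ?[l == k]eq_sym.
  by rewrite (negbTE ij) (negbTE jk) (negbTE kl) (negbTE il) /=; ring.
Qed.

Lemma St_to_E1 : St_to_E 1%g = 1%g.
Proof.
apply: presented_lift1 => [g|g|]; [exact: elemNr|exact: elemNl|].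
exact: St_to_E_rel.
Qed.

Lemma St_to_EM : {morph St_to_E : x y / (x * y)%g}.
Proof.
apply: presented_liftM => [g|g|]; [exact: elemNr|exact: elemNl|].
exact: St_to_E_rel.
Qed.

Lemma St_to_E_stx i j (ij : i != j) a : St_to_E (stx ij a) = elem ij a.
Proof.
rewrite /St_to_E /stx presented_lift_gen => [|g|g|].
- exact: finmx_eqP.
- exact: elemNr.
- exact: elemNl.
- exact: St_to_E_rel.
Qed.

Definition K2_pred : {pred St} := [pred x | St_to_E x == 1%g].

Lemma K2_group_closed : group_closed K2_pred.
Proof.
have inK2 x : reflect (St_to_E x = 1%g) (x \in K2_pred) by exact: eqP.
split=> [|x y /inK2 x1 /inK2 y1]; apply/inK2; first exact: St_to_E1.
rewrite St_to_EM x1 mul1g.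
by rewrite -[St_to_E _]mul1g -y1 -St_to_EM mulgV St_to_E1.
Qed.

Record K2 := MkK2 { K2val : St; K2valP : K2val \in K2_pred }.
HB.instance Definition _ := [isSub for K2val].
HB.instance Definition _ := [Choice of K2 by <:].
HB.instance Definition _ :=
  SubChoice_isSubGroup.Build St K2_pred K2 K2_group_closed.

Lemma neq_flip (i j : nat) : i != j -> j != i.
Proof. by rewrite eq_sym. Qed.

Definition st_w (i j : nat) (ij : i != j) (a : R) : St :=
  (stx ij a * stx (neq_flip ij) (- a^-1) * stx ij a)%g.

Definition st_h (i j : nat) (ij : i != j) (a : R) : St :=
  (st_w ij a * st_w ij (-1))%g.

(* The symbol [h_12(a), h_13(b)], with [x, y] = x y x^-1 y^-1; rows and       *)
(* columns are numbered from 0 here.                                          *)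
Definition st_symb (a b : units R) : St :=
  let h12 := @st_h 0 1 isT (uval a) in
  let h13 := @st_h 0 2 isT (uval b) in
  (h12 * h13 * h12^-1 * h13^-1)%g.

(* K_2^M(R) is generated by the symbols, so at most one f is natural. The     *)
(* group law of K_2(R), inherited from St(R), is written multiplicatively.    *)
Definition natural_K2_map (f : K2M R -> K2) : Prop :=
  {morph f : x y / x + y >-> (x * y)%g} /\
  forall a b, K2val (f (symb a b)) = st_symb a b.

End Steinberg.

Section Ideals.
Variable R : comUnitRingType.

Definition principal (t : R) : {pred R} := [pred x | `[< exists y, x = t * y >]].

Definition prime_elt (t : R) : Prop :=
  [/\ t != 0, idealr_closed (principal t) & prime_idealr_closed (principal t)].

(* idealr_closed only accepts proper ideals; the unit ideal is generated by 1. *)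
Definition noetherian : Prop :=
  forall I : {pred R}, idealr_closed I ->
  exists n (g : 'I_n -> R),
    forall x, x \in I <-> exists c : 'I_n -> R, x = \sum_i c i * g i.

Definition weakly_stable (k : nat) : Prop :=
  forall b : 'I_k.-1 -> R,
  exists2 u, u \is a GRing.unit & forall i, 1 + u * b i \is a GRing.unit.

Definition one_plus (t : R) : {pred units R} :=
  [pred u | `[< exists x, uval u = 1 + t * x >]].

Lemma one_plusP t u : reflect (exists x, uval u = 1 + t * x) (u \in one_plus t).
Proof. exact: asboolP. Qed.

Lemma one_plus_group_closed t : group_closed (one_plus t).
Proof.
split; first by apply/one_plusP; exists 0; rewrite mulr0 addr0.
move=> u v /one_plusP[x ux] /one_plusP[y vy]; apply/one_plusP.
exists ((x - y) * (uval v)^-1); rewrite /=.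
apply: (mulIr (uvalP v)); rewrite mulrVK ?uvalP // mulrDl mul1r -!mulrA.
by rewrite mulVr ?uvalP // mulr1 ux vy; ring.
Qed.

End Ideals.

Definition generated (G : groupType) (S : {pred G}) : {pred G} :=
  [pred x | `[< forall H : {pred G}, group_closed H -> {subset S <= H} ->
                x \in H >]].

Section UnitsMod.
Variables (R : comUnitRingType) (t : R).

Definition units_eqv (u v : units R) : bool := (u / v)%g \in one_plus t.

Lemma units_eqv_refl : reflexive units_eqv.
Proof. by move=> u; rewrite /units_eqv mulgV (one_plus_group_closed t).1. Qed.

Lemma units_eqv_sym : symmetric units_eqv.
Proof.
have h u v : units_eqv u v -> units_eqv v u.
  rewrite /units_eqv -(invgF u v).
  exact: group_closedV (one_plus_group_closed t) _.
by move=> u v; apply/idP/idP => /h.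
Qed.

Lemma units_eqv_trans : transitive units_eqv.
Proof.
move=> v u w uv vw; rewrite /units_eqv -(mulgVK v u) -mulgA.
exact: group_closedM (one_plus_group_closed t) _ _ uv vw.
Qed.

Canonical units_eqv_equiv :=
  EquivRel units_eqv units_eqv_refl units_eqv_sym units_eqv_trans.

(* The group R^* / (1 + tR)^*. *)
Definition units_mod := {eq_quot units_eqv}.
HB.instance Definition _ : EqQuotient _ units_eqv units_mod :=
  EqQuotient.on units_mod.
HB.instance Definition _ := Choice.on units_mod.

Definition units_class (u : units R) : units_mod := \pi u.

Definition units_mod_one : units_mod := lift_cst units_mod (1%g : units R).
Canonical pi_units_mod_one_morph := PiConst units_mod_one.
Definition units_mod_mul := lift_op2 units_mod (fun u v : units R => (u * v)%g).
Definition units_mod_inv := lift_op1 units_mod (fun u : units R => u^-1%g).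

Lemma units_eqvM u u' v v' : units_eqv u u' -> units_eqv v v' ->
  units_eqv (u * v)%g (u' * v')%g.
Proof.
move=> uu' vv'.
have e : ((u * v) / (u' * v') = (u / u') * (v / v'))%g.
  by rewrite invgM -!mulgA; congr (u * _)%g; rewrite [LHS]mulgA [LHS]units_mulC.
rewrite /units_eqv e.
exact: group_closedM (one_plus_group_closed t) _ _ uu' vv'.
Qed.

Lemma pi_units_mod_mul :
  {morph \pi_units_mod : u v / (u * v)%g >-> units_mod_mul u v}.
Proof.
move=> u v; unlock units_mod_mul; apply/eqmodP; apply: units_eqvM;
  by apply/eqmodP; rewrite reprK.
Qed.
Canonical pi_units_mod_mul_morph := PiMorph2 pi_units_mod_mul.

Lemma pi_units_mod_inv :
  {morph \pi_units_mod : u / u^-1%g >-> units_mod_inv u}.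
Proof.
move=> u; unlock units_mod_inv; apply/eqmodP.
rewrite /= /units_eqv invgK units_mulC.
by change (units_eqv (repr (\pi_units_mod u)) u); apply/eqmodP; rewrite reprK.
Qed.
Canonical pi_units_mod_inv_morph := PiMorph1 pi_units_mod_inv.

Lemma units_mod_mulA : associative units_mod_mul.
Proof. by elim/quotW=> u; elim/quotW=> v; elim/quotW=> w; rewrite !piE mulgA. Qed.
Lemma units_mod_mul1 : left_id units_mod_one units_mod_mul.
Proof. by elim/quotW=> u; rewrite !piE mul1g. Qed.
Lemma units_mod_mulr1 : right_id units_mod_one units_mod_mul.
Proof. by elim/quotW=> u; rewrite !piE mulg1. Qed.
Lemma units_mod_mulV : left_inverse units_mod_one units_mod_inv units_mod_mul.
Proof. by elim/quotW=> u; rewrite !piE mulVg. Qed.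
Lemma units_mod_mulrV : right_inverse units_mod_one units_mod_inv units_mod_mul.
Proof. by elim/quotW=> u; rewrite !piE mulgV. Qed.

HB.instance Definition _ := isGroup.Build units_mod units_mod_mulA
  units_mod_mul1 units_mod_mulr1 units_mod_mulV units_mod_mulrV.

End UnitsMod.

Section Localisations.
Variables (R : idomainType) (t : R).

(* R_t = R[1/t], as a subset of Frac R. *)
Definition away_pred : {pred {fraction R}} :=
  [pred x | `[< exists a n, x = a%:F / t%:F ^+ n >]].

Lemma away_predP x :
  reflect (exists a n, x = a%:F / t%:F ^+ n) (x \in away_pred).
Proof. exact: asboolP. Qed.

Lemma away_tofrac a : a%:F \in away_pred.
Proof. by apply/away_predP; exists a, 0%N; rewrite expr0 divr1. Qed.

Lemma away_subring_closed : subring_closed away_pred.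
Proof.
split=> [|x y /away_predP[a [n ->]] /away_predP[b [m ->]]|
          x y /away_predP[a [n ->]] /away_predP[b [m ->]]].
- by rewrite -(rmorph1 (@FracField.tofrac R)) away_tofrac.
- have [t0|t0] := eqVneq t 0.
    have h c k : exists d, c%:F / t%:F ^+ k = d%:F.
      rewrite t0 rmorph0 expr0n; case: k => [|k].
        by exists c; rewrite divr1.
      by exists 0; rewrite invr0 mulr0 rmorph0.
    have [[c ->] [d ->]] := (h a n, h b m).
    by rewrite -rmorphB away_tofrac.
  apply/away_predP; exists (a * t ^+ m - b * t ^+ n), (n + m)%N.
  have tF k : t%:F ^+ k != 0 by rewrite expf_neq0 // tofrac_eq0.
  rewrite rmorphB !rmorphM !rmorphXn exprD mulrBl; congr (_ - _).
    by rewrite invfM [X in _ = _ * X]mulrC mulrA mulfK.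
  by rewrite invfM mulrA mulfK.
- apply/away_predP; exists (a * b), (n + m)%N.
  by rewrite rmorphM exprD invfM mulrACA.
Qed.

Record away := MkAway { awayval : {fraction R}; awayvalP : awayval \in away_pred }.
HB.instance Definition _ := [isSub for awayval].
HB.instance Definition _ := [Choice of away by <:].
HB.instance Definition _ :=
  GRing.SubChoice_isSubComNzRing.Build {fraction R} away_pred away
    away_subring_closed.

Definition away_unit : {pred away} :=
  [pred x | (awayval x != 0) && ((awayval x)^-1 \in away_pred)].
Definition away_inv (x : away) : away := insubd x (awayval x)^-1.

Lemma away_mulVx : {in away_unit, left_inverse 1 away_inv *%R}.
Proof.
move=> x /andP[x0 xV]; apply/val_inj; rewrite /= /away_inv.
by rewrite [awayval (insubd _ _)](insubdK x xV) mulVf.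
Qed.

Lemma away_unitP (x y : away) : y * x = 1 -> away_unit x.
Proof.
move=> /(congr1 awayval) /= yx; have x0 : awayval x != 0.
  by apply: contra_eq_neq yx => ->; rewrite mulr0 eq_sym oner_neq0.
rewrite /away_unit /= x0 /=.
suff -> : (awayval x)^-1 = awayval y by exact: awayvalP.
by apply: (mulIf x0); rewrite mulVf // yx.
Qed.

Lemma away_inv_out : {in [predC away_unit], away_inv =1 id}.
Proof.
move=> x xNU; apply/val_inj; rewrite val_insubd; case: ifP => // xV.
have [e|x0] := eqVneq (awayval x) 0; first by rewrite /= e invr0.
by case/negP: xNU; apply/andP.
Qed.

HB.instance Definition _ := GRing.ComNzRing_hasMulInverse.Build away
  away_mulVx away_unitP away_inv_out.

Definition to_away (a : R) : away := MkAway (away_tofrac a).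

Lemma to_away_is_zmod_morphism : zmod_morphism to_away.
Proof. by move=> a b; apply/val_inj; rewrite /= rmorphB. Qed.
Lemma to_away_is_monoid_morphism : monoid_morphism to_away.
Proof. by split=> [|a b]; apply/val_inj; rewrite /= ?rmorph1 ?rmorphM. Qed.
HB.instance Definition _ :=
  GRing.isZmodMorphism.Build R away to_away to_away_is_zmod_morphism.
HB.instance Definition _ :=
  GRing.isMonoidMorphism.Build R away to_away to_away_is_monoid_morphism.

(* R_{tR}, as a subset of Frac R. *)
Definition localised_pred : {pred {fraction R}} :=
  [pred x | `[< exists a s, s \notin principal t /\ x = a%:F / s%:F >]].

(* The t-adic valuation of x is the n such that x is t ^ n times a unit of    *)
(* R_{tR}; the value at x = 0 is irrelevant.                                  *)
Definition t_valuation (x : {fraction R}) : int :=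
  xget 0 [set n : int | exists a s,
    [/\ a \notin principal t, s \notin principal t
      & x = t%:F ^ n * (a%:F / s%:F)]].

Definition tame_symbol (f g : {fraction R}) : {fraction R} :=
  (-1) ^ (t_valuation f * t_valuation g) *
  f ^ t_valuation g * g ^ (- t_valuation f).

End Localisations.

(* The elements of (1 + tR)^* of the form 1 + tw with w a unit. *)
Definition one_plus_unit (R : comUnitRingType) (t : R) : {pred units R} :=
  [pred u | `[< exists w : units R, uval u = 1 + t * uval w >]].

(* Main.v *)
Require Import Defs.
From HB Require Import structures.
From mathcomp Require Import all_boot all_order all_algebra.
From mathcomp Require Import boolp classical_sets ring zify.

Set Implicit Arguments.
Unset Strict Implicit.
Unset Printing Implicit Defensive.

Import Order.TTheory GRing.Theory.
Local Open Scope quotient_scope.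
Local Open Scope ring_scope.

(** Write R_t = R[1/t]. Every unit of R_t is u t^n with u a unit of R, so by
    bilinearity and antisymmetry every element of K_2^M(R_t) has the form
    k + {c, t} with k coming from K_2^M(R) and c in R^x, and the tame symbol
    reads off c. At the level of words in the symbols {f, g} the pair (k, c)
    can be written down explicitly ([word_symb], [word_val]), and it is
    additive in the word. The whole theorem is the determination of the pairs
    (k, c) that represent 0.

    When w is a unit, {1 + tw, -tw} = 0, so {1 + tw, t} = - {1 + tw, -w} comes
    from K_2^M(R). This handles the kernel of the tame symbol, since such
    elements generate (1 + tR)^x. It also says that the pairs representing 0
    ought to be the graph of a homomorphism on a subgroup of (1 + tR)^x with
    value {1 + tw, -w} at 1 + tw. Injectivity of K_2^M(R) -> K_2^M(R_t) is the
    consistency of this prescription: relations between the elements 1 + tw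
    must not impose relations between the symbols {1 + tw, -w}.

    Consistency comes from the Steinberg group. For 1 + ab a unit there is a
    Dennis-Stein symbol <a, b> in K_2(R), here [dsymb], such that
    - <a, b> <a, c> = <a, b + c + abc> ([dsymb_circ]), which means that
      1 + tx |-> <t, x> is a homomorphism;
    - <ab, c> = <a, bc> <b, ca> ([dsymb_mull]);
    - <a, b> is the Steinberg symbol {1 + ab, -b} if b is a unit
      ([dsymb_st_symb]).
    As K_2^M(R) -> K_2(R) is injective, the relation [tame_rel], by which k is
    sent to <t, x> and c = 1 + tx, is the graph of a homomorphism. It remains
    to see that it contains the pair of every Steinberg relation f + g = 1 of
    R_t. Comparing valuations, f + g = 1 comes down to v = 1 + t^N w with
    v, w units of R, and then what has to be known is the N-th power of
    <t, t^(N-1) w>: it is <t^N, w> by the second rule, hence {v, -w} by the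
    third one ([tame_rel_steinberg]).

    The three rules are computations with
      H(a, b) = x_21(-b/D) x_12(a) x_21(b) x_12(-a/D),  D = 1 + ab,
    a lift of diag(D, 1/D) to the Steinberg group ([diagw]). Two such lifts
    with the same D differ by an element commuting with everything in sight,
    and <a, b> is the quotient H(a, b) / H(1, ab). *)

(** * Intertwining relations in a group *)

Section Intertwining.
Variable G : groupType.
Local Open Scope group_scope.

(** Conjugation of x into y by g, without inverses; in this form the factors
    of a product of Steinberg generators are moved past one another. *)
Definition intertwines (g x y : G) := g * x = y * g.

Lemma intertwinesM g x y x' y' : intertwines g x y -> intertwines g x' y' ->
  intertwines g (x * x') (y * y').
Proof. by rewrite /intertwines => e e'; rewrite mulgA e -!mulgA e'. Qed.

Lemma intertwinesV g x y : intertwines g x y -> intertwines g x^-1 y^-1.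
Proof.
by rewrite /intertwines => e; apply: (mulgI y); rewrite mulgA -e mulgK mulVKg.
Qed.

Lemma intertwines_eq g x y z : intertwines g x y -> y = z -> intertwines g x z.
Proof. by move=> ? <-. Qed.

Lemma intertwines_comp g h x y z : intertwines h x y -> intertwines g y z ->
  intertwines (g * h) x z.
Proof. by rewrite /intertwines => e e'; rewrite -mulgA e mulgA e' mulgA. Qed.

Lemma intertwines_inv g x y : intertwines g x y -> intertwines g^-1 y x.
Proof.
rewrite /intertwines => e.
by apply: (mulgI g); rewrite !mulgA mulgV mul1g e mulgK.
Qed.

Lemma intertwinesR g x y x' y' : intertwines g x y -> intertwines g x' y' ->
  intertwines g (x * x' * x^-1 * x'^-1) (y * y' * y^-1 * y'^-1).
Proof. by move=> e e'; do !apply: intertwinesM => //; apply: intertwinesV. Qed.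

(** Two elements with the same conjugation action differ by a centralising
    one; this is how all centrality statements below arise. *)
Lemma intertwines_quotient g h x y :
  intertwines g x y -> intertwines h x y -> intertwines (g / h) y y.
Proof. by move=> gxy hxy; apply: intertwines_comp (intertwines_inv hxy) gxy. Qed.

End Intertwining.

(** * Steinberg generators *)

Section PresentedWords.
Variables (X : choiceType) (rel : word X -> word X -> Prop).
Local Notation letter p := (if p.2 then pgen p.1 else (pgen p.1)^-1)%g.

Lemma pi_word (w : word X) :
  (\pi w : presented rel) = (\prod_(p <- w) letter p)%g.
Proof.
elim: w => [|[x b] w IH]; first by rewrite big_nil; exact: pi_presented_one.
rewrite big_cons -IH -cat1s [LHS]pi_presented_mul /=.
by congr (presented_mul _ _); case: b => //=; rewrite -[RHS]pi_presented_inv.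
Qed.

Lemma presented_rel (u v : word X) : rel u v ->
  (\prod_(p <- u) letter p = \prod_(p <- v) letter p :> presented rel)%g.
Proof. by move=> uv; rewrite -!pi_word; apply/presented_eqP/WCrel. Qed.

End PresentedWords.

Section SteinbergCalculus.
Variable R : comUnitRingType.
Implicit Types (i j k : nat) (a b c p r s : R).

(** The generator x_ij(a), extended by 1 to i = j so that the indices need not
    carry a proof of i != j. *)
Definition ste i j a : St R :=
  if insub (i, j) is Some ij then pgen ((ij, a) : St_gen R) else 1%g.

Lemma steE i j (ij : i != j) a : ste i j a = stx ij a.
Proof.
rewrite /ste insubT /stx /st_gen /=.
by congr (pgen (_, _)); apply/val_inj.
Qed.

Lemma ste_diag i a : ste i i a = 1%g.
Proof. by rewrite /ste insubF //= eqxx. Qed.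

Lemma ste_add i j a b : (ste i j a * ste i j b)%g = ste i j (a + b).
Proof.
have [->|ij] := eqVneq i j; first by rewrite !ste_diag mulg1.
rewrite !(steE ij); have := presented_rel (St_add ij a b).
by rewrite !big_cons !big_nil /= !mulg1.
Qed.

Lemma ste0 i j : ste i j 0 = 1%g.
Proof. by apply: (mulgI (ste i j 0)); rewrite ste_add addr0 mulg1. Qed.

Lemma steN i j a : ste i j (- a) = (ste i j a)^-1%g.
Proof. by apply: (mulgI (ste i j a)); rewrite ste_add subrr ste0 mulgV. Qed.

Lemma ste_comm i j k a b : i != j -> j != k -> i != k ->
  (ste i j a * ste j k b * (ste i j a)^-1 * (ste j k b)^-1)%g = ste i k (a * b).
Proof.
move=> ij jk ik; rewrite !steE; have := presented_rel (St_comm ij jk ik a b).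
by rewrite !big_cons !big_nil /= !mulg1 !mulgA.
Qed.

Lemma ste_swap i j k a b : i != j -> j != k -> i != k ->
  (ste i j a * ste j k b = ste i k (a * b) * ste j k b * ste i j a)%g.
Proof. by move=> ij jk ik; rewrite -(ste_comm a b ij jk ik) !mulgVK. Qed.

Lemma ste_commute i j k l a b : i != j -> k != l -> j != k -> i != l ->
  (ste i j a * ste k l b = ste k l b * ste i j a)%g.
Proof.
move=> ij kl jk il; rewrite !steE.
have := presented_rel (St_comm1 ij kl a b jk il).
rewrite !big_cons !big_nil /= !mulg1 !mulgA.
by move=> /divg1_eq /(canRL (mulgVK _)) ->.
Qed.

End SteinbergCalculus.

(** * Lifts of diagonal matrices to the Steinberg group *)

(** A lift of the matrix with entries 1 + ab and 1 / (1 + ab) at the places i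
    and j of the diagonal: the middle part of the factorisation
    lower * diagonal * upper of e_ij(a) e_ji(b). It is locked because matching
    modulo associativity would otherwise unfold it. *)
HB.lock Definition diagw (R : comUnitRingType) (i j : nat) (a b : R) : St R :=
  (ste j i (- (b / (1 + a * b))) * ste i j a * ste j i b *
   ste i j (- (a / (1 + a * b))))%g.

(** The element w_ij(u), with total generators. *)
HB.lock Definition weylw (R : comUnitRingType) (i j : nat) (u : R) : St R :=
  (ste i j u * ste j i (- u^-1) * ste i j u)%g.

Section DiagonalWords.
Variable R : comUnitRingType.
Local Notation ste := (@ste R).

Section ThreeIndices.
Variables i j k : nat.
Hypotheses (ij : i != j) (jk : j != k) (ik : i != k).
Let ji : j != i. Proof. by rewrite eq_sym. Qed.
Let kj : k != j. Proof. by rewrite eq_sym. Qed.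
Let ki : k != i. Proof. by rewrite eq_sym. Qed.

Local Notation col s r := (ste i k s * ste j k r)%g.
Local Notation row s r := (ste k i s * ste k j r)%g.

(** A word in x_ij and x_ji acts by conjugation on the pairs x_ik(s) x_jk(r) as
    its 2 x 2 matrix acts on columns, and on the pairs x_ki(s) x_kj(r) as the
    inverse matrix acts on rows. All scaling rules follow from these. *)
Lemma intertwines_col p s r :
  intertwines (ste i j p) (col s r) (col (s + p * r) r).
Proof.
rewrite /intertwines !mulgA (@ste_commute _ i j i k) //.
by rewrite -(mulgA (ste i k s)) (ste_swap _ _ ij jk ik) !mulgA ste_add.
Qed.

Lemma intertwines_row p s r :
  intertwines (ste i j p) (row s r) (row s (r - s * p)).
Proof.
have e : (ste i j p * ste k i s = ste k i s * ste k j (- (s * p)) * ste i j p)%g.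
  rewrite (@ste_commute _ k i k j) //.
  apply: (mulgI (ste k j (s * p))); rewrite !mulgA -ste_swap // ste_add.
  by rewrite addrN ste0 mul1g.
rewrite /intertwines mulgA e -!mulgA (@ste_commute _ i j k j) //.
by rewrite !mulgA -(mulgA (ste k i s) (ste k j _)) ste_add addrC.
Qed.

End ThreeIndices.

Section DiagonalAction.
Variables i j k : nat.
Hypotheses (ij : i != j) (jk : j != k) (ik : i != k).
Let ji : j != i. Proof. by rewrite eq_sym. Qed.
Let kj : k != j. Proof. by rewrite eq_sym. Qed.
Let ki : k != i. Proof. by rewrite eq_sym. Qed.

Local Notation col s r := (ste i k s * ste j k r)%g.
Local Notation row s r := (ste k i s * ste k j r)%g.

Lemma intertwines_col_op p s r :
  intertwines (ste j i p) (col s r) (col s (r + p * s)).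
Proof.
have c s' r' : (col s' r' = ste j k r' * ste i k s')%g by exact: ste_commute.
by rewrite !c; exact: intertwines_col.
Qed.

Lemma intertwines_row_op p s r :
  intertwines (ste j i p) (row s r) (row (s - r * p) r).
Proof.
have c s' r' : (row s' r' = ste k j r' * ste k i s')%g by exact: ste_commute.
by rewrite !c; exact: intertwines_row.
Qed.

Section Diag.
Variables a b : R.
Hypothesis D_unit : 1 + a * b \is a GRing.unit.
Let D := 1 + a * b.
Let DV : D * D^-1 = 1. Proof. exact: mulrV. Qed.

Lemma diagw_col s r :
  intertwines (diagw i j a b) (col s r) (col (D * s) (D^-1 * r)).
Proof.
rewrite diagw.unlock -/D; apply: intertwines_eq.
  apply: intertwines_comp (intertwines_col ij jk ik _ _ _) _.
  apply: intertwines_comp (intertwines_col_op _ _ _) _.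
  apply: intertwines_comp (intertwines_col ij jk ik _ _ _) _.
  exact: intertwines_col_op.
have h : a * b * D^-1 = 1 - D^-1 by rewrite -[X in X - _]DV /D; ring.
by congr (ste _ _ _ * ste _ _ _)%g; rewrite /D; ring: h.
Qed.

Lemma diagw_row s r :
  intertwines (diagw i j a b) (row s r) (row (D^-1 * s) (D * r)).
Proof.
rewrite diagw.unlock -/D; apply: intertwines_eq.
  apply: intertwines_comp (intertwines_row ij jk ik _ _ _) _.
  apply: intertwines_comp (intertwines_row_op _ _ _) _.
  apply: intertwines_comp (intertwines_row ij jk ik _ _ _) _.
  exact: intertwines_row_op.
have h : a * b * D^-1 = 1 - D^-1 by rewrite -[X in X - _]DV /D; ring.
by congr (ste _ _ _ * ste _ _ _)%g; rewrite /D; ring: h.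
Qed.

Lemma diagw_ik s : intertwines (diagw i j a b) (ste i k s) (ste i k (D * s)).
Proof. by have := diagw_col s 0; rewrite !mulr0 ste0 !mulg1. Qed.

Lemma diagw_jk s : intertwines (diagw i j a b) (ste j k s) (ste j k (D^-1 * s)).
Proof. by have := diagw_col 0 s; rewrite !mulr0 ste0 !mul1g. Qed.

Lemma diagw_ki s : intertwines (diagw i j a b) (ste k i s) (ste k i (D^-1 * s)).
Proof. by have := diagw_row s 0; rewrite !mulr0 ste0 !mulg1. Qed.

Lemma diagw_kj s : intertwines (diagw i j a b) (ste k j s) (ste k j (D * s)).
Proof. by have := diagw_row 0 s; rewrite !mulr0 ste0 !mul1g. Qed.

(** The rules in the plane of i and j itself follow by writing x_ij as a
    commutator that passes through the third index. *)
Lemma diagw_ij s :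
  intertwines (diagw i j a b) (ste i j s) (ste i j (D ^+ 2 * s)).
Proof.
have := intertwinesR (diagw_ik s) (diagw_kj 1).
by rewrite !ste_comm // mulr1 [D ^+ 2 * s](_ : _ = D * s * (D * 1)) //; ring.
Qed.

Lemma diagw_ji s :
  intertwines (diagw i j a b) (ste j i s) (ste j i (D^-1 ^+ 2 * s)).
Proof.
have := intertwinesR (diagw_jk s) (diagw_ki 1).
rewrite !ste_comm // mulr1.
by rewrite [D^-1 ^+ 2 * s](_ : _ = D^-1 * s * (D^-1 * 1)) //; ring.
Qed.

End Diag.

Section Weyl.
Variable u : R.
Hypothesis u_unit : u \is a GRing.unit.

Lemma weylw_col s r :
  intertwines (weylw i j u) (col s r) (col (u * r) (- (u^-1 * s))).
Proof.
rewrite weylw.unlock; apply: intertwines_eq.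
  apply: intertwines_comp (intertwines_col ij jk ik _ _ _) _.
  apply: intertwines_comp (intertwines_col_op _ _ _) _.
  exact: intertwines_col.
have := mulrV u_unit; move: u^-1 => E h.
by congr (ste _ _ _ * ste _ _ _)%g; ring: h.
Qed.

Lemma weylw_row s r :
  intertwines (weylw i j u) (row s r) (row (u^-1 * r) (- (u * s))).
Proof.
rewrite weylw.unlock; apply: intertwines_eq.
  apply: intertwines_comp (intertwines_row ij jk ik _ _ _) _.
  apply: intertwines_comp (intertwines_row_op _ _ _) _.
  exact: intertwines_row.
have := mulrV u_unit; move: u^-1 => E h.
by congr (ste _ _ _ * ste _ _ _)%g; ring: h.
Qed.

Lemma weylw_ij s :
  intertwines (weylw i j u) (ste i j s) (ste j i (- (u^-1 ^+ 2 * s))).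
Proof.
have := intertwinesR (weylw_col s 0) (weylw_row 0 1).
rewrite !mulr0 !oppr0 !ste0 !mul1g !mulg1 !ste_comm // mulr1.
by congr (intertwines _ _ (ste _ _ _)); ring.
Qed.

Lemma weylw_ji s :
  intertwines (weylw i j u) (ste j i s) (ste i j (- (u ^+ 2 * s))).
Proof.
have := intertwinesR (weylw_col 0 s) (weylw_row 1 0).
rewrite !mulr0 !oppr0 !ste0 !mul1g !mulg1 !ste_comm // mulr1.
by congr (intertwines _ _ (ste _ _ _)); ring.
Qed.

(** Conjugation by w_ij(u) exchanges its factors x_ij(u) and x_ji(-1/u); apply
    it to w_ij(u) itself. *)
Lemma weylw_flip :
  weylw i j u = (ste j i (- u^-1) * ste i j u * ste j i (- u^-1))%g.
Proof.
set w := weylw i j u.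
have c1 : intertwines w (ste i j u) (ste j i (- u^-1)).
  have := weylw_ij u; congr (intertwines _ _ (ste _ _ _)).
  by have := mulrV u_unit; move: u^-1 => E h; ring: h.
have c2 : intertwines w (ste j i (- u^-1)) (ste i j u).
  have := weylw_ji (- u^-1); congr (intertwines _ _ (ste _ _ _)).
  by have := mulrV u_unit; move: u^-1 => E h; ring: h.
have : intertwines w w (ste j i (- u^-1) * ste i j u * ste j i (- u^-1))%g.
  by rewrite {2}/w weylw.unlock; do !apply: intertwinesM.
exact: mulIg.
Qed.

End Weyl.
End DiagonalAction.
End DiagonalWords.

Section DennisStein.
Variable R : comUnitRingType.
Local Notation ste := (@ste R).
Implicit Types (a b c u : R).

Lemma ste_mul_op i j a b :
  (ste i j a * ste j i b =
   ste j i (b / (1 + a * b)) * diagw i j a b * ste i j (a / (1 + a * b)))%g.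
Proof.
by rewrite diagw.unlock !mulgA ste_add addrN ste0 mul1g !steN !mulgVK.
Qed.

Section ThreeIndices.
Variables i j k : nat.
Hypotheses (ij : i != j) (jk : j != k) (ik : i != k).
Let ji : j != i. Proof. by rewrite eq_sym. Qed.
Let kj : k != j. Proof. by rewrite eq_sym. Qed.
Let ki : k != i. Proof. by rewrite eq_sym. Qed.

(** Factor x_ij(a) x_ji(b) x_ji(cD) in two steps, where D = 1 + ab. The second
    factor is H_ij(a, c) conjugated by a lift of diag(1/D, 1), so this is a
    cocycle identity for 1 + ax |-> H_ij(a, x). *)
Lemma diagw_cocycle a b c :
    1 + a * b \is a GRing.unit -> 1 + a * c \is a GRing.unit ->
  diagw i j a (b + c * (1 + a * b)) =
  (diagw i j a b * diagw i j (a / (1 + a * b)) (c * (1 + a * b)))%g.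
Proof.
move=> uD uE; set D := 1 + a * b in uD *; set E := 1 + a * c in uE *.
have D2 : 1 + a / D * (c * D) = E by rewrite mulrACA mulVr // mulr1.
have D3 : 1 + a * (b + c * D) = D * E by rewrite /D /E; ring.
have DEV : (D * E)^-1 = D^-1 * E^-1 by rewrite invrM // mulrC.
have hE : a * c * E^-1 = 1 - E^-1 by rewrite -[X in X - _](mulrV uE) /E; ring.
have e : (ste i j a * ste j i (b + c * D) = ste j i (b / D + c / (D * E)) *
    diagw i j a b * diagw i j (a / D) (c * D) * ste i j (a / (D * E)))%g.
  rewrite -ste_add mulgA ste_mul_op -/D -[LHS]mulgA (ste_mul_op i j (a / D)) D2.
  rewrite !mulgA -(mulgA (ste j i (b / D))) (diagw_ji ij jk ik uD) -/D.
  rewrite mulgA ste_add DEV (mulrA a); congr (ste j i (_ + _) * _ * _ * _)%g.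
  by have h := mulrV uD; ring: h.
rewrite {1}diagw.unlock D3 -2!mulgA [X in (_ * X)%g]mulgA e !mulgA ste_add.
rewrite -[LHS]mulgA ste_add addrN ste0 mulg1.
rewrite (_ : _ + _ = 0) ?ste0 ?mul1g // DEV /D.
by ring: hE.
Qed.

(** Write x_ij(ab) = [x_ik(a), x_kj(b)] and conjugate the commutator by
    x_ji(c). It becomes [A, B] with A = x_ik(a) x_jk(-ca) and
    B = x_ki(bc) x_kj(b), and in the product A B A^-1 B^-1 the adjacent opposite
    generators x_ik(a) x_ki(bc) and x_kj(b) x_jk(ca) produce H_ik(a, bc) and
    H_kj(b, ca). The remaining generators cancel. *)
Lemma diagw_split a b c : 1 + a * b * c \is a GRing.unit ->
  diagw i j (a * b) c = (diagw i k a (b * c) * diagw k j b (c * a))%g.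
Proof.
set D := 1 + a * b * c => uD.
have Dik : 1 + a * (b * c) = D by rewrite mulrA.
have Dkj : 1 + b * (c * a) = D by rewrite /D; ring.
have uik : 1 + a * (b * c) \is a GRing.unit by rewrite Dik.
have ukj : 1 + b * (c * a) \is a GRing.unit by rewrite Dkj.
set P := diagw i k a (b * c); set Q := diagw k j b (c * a).
(* h is made opaque, so that rewriting does not see the product P Q in it. *)
have [h hE] : {h : St R | h = P * Q}%g by exists (P * Q)%g.
rewrite -hE.
have hD : a * b * c * D^-1 = 1 - D^-1 by rewrite -[X in X - _](mulrV uD) /D; ring.
have DV := mulrV uD.
have Pik s : (P * ste i k s = ste i k (D ^+ 2 * s) * P)%g.
  by rewrite -Dik; exact (diagw_ij ik kj ij uik s).
have Pjk s : (P * ste j k s = ste j k (D * s) * P)%g.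
  by rewrite -Dik; exact (diagw_kj ik kj ij uik s).
(* h lifts a diagonal matrix with entries D, 1/D, 1 at i, j, k. *)
have hkj s : (h * ste k j s = ste k j (D * s) * h)%g.
  rewrite hE; apply: intertwines_eq (intertwines_comp
    (diagw_ij kj ji ki ukj s) (diagw_jk ik kj ij uik _)) _.
  by rewrite Dik Dkj; congr ste; ring: DV.
have hik s : (h * ste i k s = ste i k (D * s) * h)%g.
  rewrite hE; apply: intertwines_eq (intertwines_comp
    (diagw_ki kj ji ki ukj s) (diagw_ij ik kj ij uik _)) _.
  by rewrite Dik Dkj; congr ste; ring: DV.
have hki s : (h * ste k i s = ste k i (D^-1 * s) * h)%g.
  rewrite hE; apply: intertwines_eq (intertwines_comp
    (diagw_ik kj ji ki ukj s) (diagw_ji ik kj ij uik _)) _.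
  by rewrite Dik Dkj; congr ste; ring: DV.
have hij s : (h * ste i j s = ste i j (D ^+ 2 * s) * h)%g.
  rewrite hE; apply: intertwines_eq (intertwines_comp
    (diagw_kj kj ji ki ukj s) (diagw_ik ik kj ij uik _)) _.
  by rewrite Dik Dkj; congr ste; ring.
pose A := (ste i k a * ste j k (- (c * a)))%g.
pose B := (ste k i (b * c) * ste k j b)%g.
have e : (ste i j (a * b) * ste j i c = ste j i c * (A * B * A^-1 * B^-1))%g.
  rewrite -(ste_comm a b ik kj ij); apply/esym/intertwinesR.
    apply: intertwines_eq (intertwines_col_op ij jk ik _ _ _) _.
    by rewrite addNr ste0 mulg1.
  apply: intertwines_eq (intertwines_row_op ij jk ik _ _ _) _.
  by rewrite subrr ste0 mul1g.
have eAB : (A * B * A^-1 * B^-1 = ste j k (- (c * a)) * ste k i (b * c / D) *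
     ste i k (D * a) * ste j k (c * a) * h *
     ste k j (b / D) * ste i k (- a) * ste k j (- b) * ste k i (- (b * c)))%g.
  rewrite /A /B {1}(@ste_commute _ i k j k) // !invgM -!steN opprK !mulgA.
  rewrite -(mulgA _ (ste i k a)) (ste_mul_op i k a) Dik -/P !mulgA.
  rewrite -(mulgA _ (ste k j b)) (ste_mul_op k j b) Dkj -/Q !mulgA.
  rewrite -(mulgA _ P) Pik !mulgA -(mulgA _ P) Pjk !mulgA -(mulgA _ P Q) -hE.
  congr (_ * ste i k _ * ste j k _ * _ * _ * _ * _ * _)%g; first by ring: DV.
  by ring: DV.
have eT : (h * ste k j (b / D) * ste i k (- a) * ste k j (- b) *
    ste k i (- (b * c)) = ste k j b * ste i k (- (D * a)) * ste k j (- (D * b)) *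
    ste k i (- (b * c / D)) * h)%g.
  rewrite hkj -(mulgA _ h) hik !mulgA -(mulgA _ h) hkj !mulgA -(mulgA _ h) hki.
  rewrite !mulgA; congr (ste _ _ _ * ste _ _ _ * ste _ _ _ * ste _ _ _ * _)%g;
    by ring: DV.
(* Only x_ji and x_ij survive; the rest is a calculation with commutators. *)
have eW : (ste j k (- (c * a)) * ste k i (b * c / D) * ste i k (D * a) *
    ste j k (c * a) * (ste k j b * ste i k (- (D * a)) * ste k j (- (D * b)) *
    ste k i (- (b * c / D))) =
    ste j i (- (c * a) * (b * c / D)) * ste i j (D * a * b))%g.
  rewrite (@ste_swap _ j k i) // -!mulgA; congr (_ * _)%g; rewrite !mulgA.
  rewrite -(mulgA _ (ste j k _) (ste i k _)) (@ste_commute _ j k i k) // !mulgA.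
  rewrite -(mulgA _ (ste j k _) (ste j k _)) ste_add addNr ste0 mulg1.
  rewrite -(mulgA _ (ste i k (D * a)) (ste k j _)) (@ste_swap _ i k j) // !mulgA.
  rewrite -(mulgA _ (ste i k _) (ste i k _)) ste_add subrr ste0 mulg1.
  rewrite (@ste_swap _ k i j) // -!mulgA (mulgA (ste k j b)) ste_add.
  rewrite (@ste_commute _ k j k i) // (mulgA (ste k i _)) ste_add subrr ste0 mul1g.
  rewrite (@ste_commute _ i j k j) // mulgA ste_add.
  rewrite (_ : _ + _ = 0) ?ste0 ?mul1g //.
  have -> : b * c / D * (D * a * b) = b * c * (a * b) by ring: DV.
  by rewrite /D; ring.
rewrite diagw.unlock -/D -(mulgA _ (ste i j (a * b))) e.
have -> : (A * B * A^-1 * B^-1 =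
    ste j i (- (c * a) * (b * c / D)) * ste i j (D * a * b) * h)%g.
  by rewrite eAB -eW -[RHS]mulgA -eT !mulgA.
rewrite !mulgA !ste_add -(mulgA _ h) hij mulgA.
rewrite -(mulgA _ (ste i j _) (ste i j _)) ste_add.
have -> : D ^+ 2 * - (a * b / D) = - (D * a * b).
  by ring: DV.
have -> : - (c / D) + c + - (c * a) * (b * c / D) = 0.
  have -> : - (c * a) * (b * c / D) = - c * (a * b * c / D) by ring.
  by rewrite hD; ring.
by rewrite addrN !ste0 !mul1g.
Qed.

End ThreeIndices.
End DennisStein.

(** * Dennis-Stein symbols *)

(** Both factors lift the same diagonal matrix, so this lies in K_2(R). The
    choice of H_ij(1, ab) as the denominator makes <1, b> trivial, and for a
    fixed a both factors satisfy the cocycle identity in b. *)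
HB.lock Definition dsymb (R : comUnitRingType) (i j : nat) (a b : R) : St R :=
  (diagw i j a b / diagw i j 1 (a * b))%g.

Section DennisSteinSymbols.
Variable R : comUnitRingType.
Local Notation ste := (@ste R).
Implicit Types (a b c u : R).

Lemma st_hE i j (ij : i != j) a :
  st_h ij a = (weylw i j a * weylw i j (-1))%g.
Proof.
have ji := neq_flip ij.
rewrite weylw.unlock !(steE ij) !(steE ji) /st_h /st_w.
by rewrite (bool_irrelevance (neq_flip ij) ji).
Qed.

Section ThreeIndices.
Variables i j k : nat.
Hypotheses (ij : i != j) (jk : j != k) (ik : i != k).
Let ji : j != i. Proof. by rewrite eq_sym. Qed.
Let kj : k != j. Proof. by rewrite eq_sym. Qed.
Let ki : k != i. Proof. by rewrite eq_sym. Qed.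

(** The diagonal elements that define Steinberg symbols are instances of
    [diagw], so all scaling rules hold for them. *)
Lemma st_h_diagw a : a \is a GRing.unit -> st_h ij a = diagw i j (a - 1) 1.
Proof.
move=> ua; have aV := mulrV ua.
have u1 : (-1 : R) \is a GRing.unit by rewrite unitrN1.
have Da : 1 + (a - 1) * 1 = a by rewrite mulr1 addrC subrK.
rewrite st_hE diagw.unlock Da div1r -ste_add.
rewrite (_ : - ((a - 1) / a) = -1 + a^-1); last by ring: aV.
rewrite -ste_add !mulgA.
have -> : (ste j i (- a^-1) * ste i j a * ste i j (-1) * ste j i 1 *
  ste i j (-1) * ste i j a^-1 = ste j i (- a^-1) * ste i j a *
   (weylw i j (-1) * ste i j a^-1))%g.
  by rewrite weylw.unlock invrN1 opprK !mulgA.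
rewrite (weylw_ij ij jk ik u1) (weylw_flip ij jk ik ua) !mulgA.
by rewrite invrN1 sqrrN expr1n mul1r.
Qed.

(** Both sides are w_ij(-D) w_ij(1) for D = 1 + b. This compares the
    normalisation used in [dsymb] with h_ij(D) = H_ij(b, 1): they are exchanged
    by diag(-1, 1). *)
Lemma diagw1 b : 1 + b \is a GRing.unit -> diagw i j 1 b = diagw i j (- b) (-1).
Proof.
move=> ua; have [a aE] : {a | a = 1 + b} by exists (1 + b).
have bE : b = a - 1 by rewrite aE; ring.
rewrite -aE {aE} in ua; rewrite bE {b bE}; have aV := mulrV ua.
have u1 : (1 : R) \is a GRing.unit by rewrite unitr1.
have Dl : 1 + 1 * (a - 1) = a by ring.
have Dr : 1 + - (a - 1) * -1 = a by ring.
rewrite !diagw.unlock Dl Dr.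
have el : - ((a - 1) / a) = a^-1 - 1 by ring: aV.
have er : - (- (a - 1) / a) = 1 - a^-1 by ring: aV.
rewrite el er div1r !mulNr div1r opprK opprB [1 - a]addrC [a - 1]addrC -!ste_add.
rewrite [LHS](_ : _ =
    ste j i a^-1 * (weylw i j 1 * ste j i a) * ste i j (- a^-1))%g.
  rewrite (weylw_ji ij jk ik u1) expr1n mul1r.
  by rewrite weylw.unlock invr1 !mulgA.
by rewrite (weylw_flip ij jk ik u1) invr1 !mulgA.
Qed.

Lemma diagw_scale u v a b : 1 + u * v \is a GRing.unit ->
    1 + a * b \is a GRing.unit ->
  intertwines (diagw i k u v) (diagw i j a b)
    (diagw i j ((1 + u * v) * a) (b / (1 + u * v))).
Proof.
move=> uw uD; set w := 1 + u * v in uw *; have wV := mulrV uw.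
rewrite {2 3}diagw.unlock.
have D' : 1 + w * a * (b / w) = 1 + a * b by ring: wV.
have cij s : intertwines (diagw i k u v) (ste i j s) (ste i j (w * s)).
  exact (diagw_ik ik kj ij uw s).
have cji s : intertwines (diagw i k u v) (ste j i s) (ste j i (w^-1 * s)).
  exact (diagw_ki ik kj ij uw s).
apply: intertwines_eq.
  by do !apply: intertwinesM; (exact: cij || exact: cji).
by rewrite D'; congr (ste _ _ _ * ste _ _ _ * ste _ _ _ * ste _ _ _)%g; ring.
Qed.

End ThreeIndices.
End DennisSteinSymbols.

(** * Relations between Dennis-Stein symbols *)

Section Centrality.
Variable R : comUnitRingType.
Local Notation ste := (@ste R).
Implicit Types (a b c u : R).

Section ThreeIndices.
Variables i j k : nat.
Hypotheses (ij : i != j) (jk : j != k) (ik : i != k).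
Let ji : j != i. Proof. by rewrite eq_sym. Qed.
Let kj : k != j. Proof. by rewrite eq_sym. Qed.
Let ki : k != i. Proof. by rewrite eq_sym. Qed.

(** The two factors of [dsymb] act in the same way on the generators that
    involve the third index k, and these generate the remaining two. *)
Lemma dsymb_ste a b p q s : 1 + a * b \is a GRing.unit ->
    p \in [:: i; j; k] -> q \in [:: i; j; k] ->
  intertwines (dsymb i j a b) (ste p q s) (ste p q s).
Proof.
move=> uD; rewrite dsymb.unlock; set D := 1 + a * b in uD *.
have uD1 : 1 + 1 * (a * b) \is a GRing.unit by rewrite mul1r.
set d := (diagw i j a b / diagw i j 1 (a * b))%g.
have mD t : t = D * (D^-1 * t) by rewrite mulrA mulrV // mul1r.
have mDV t : t = D^-1 * (D * t) by rewrite mulrA mulVr // mul1r.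
have Cik t : intertwines d (ste i k t) (ste i k t).
  rewrite (mD t); apply: intertwines_quotient (diagw_ik ij jk ik uD _) _.
  by have := diagw_ik ij jk ik uD1 (D^-1 * t); rewrite mul1r.
have Cjk t : intertwines d (ste j k t) (ste j k t).
  rewrite (mDV t); apply: intertwines_quotient (diagw_jk ij jk ik uD _) _.
  by have := diagw_jk ij jk ik uD1 (D * t); rewrite mul1r.
have Cki t : intertwines d (ste k i t) (ste k i t).
  rewrite (mDV t); apply: intertwines_quotient (diagw_ki ij jk ik uD _) _.
  by have := diagw_ki ij jk ik uD1 (D * t); rewrite mul1r.
have Ckj t : intertwines d (ste k j t) (ste k j t).
  rewrite (mD t); apply: intertwines_quotient (diagw_kj ij jk ik uD _) _.
  by have := diagw_kj ij jk ik uD1 (D^-1 * t); rewrite mul1r.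
rewrite !inE => /or3P[] /eqP-> /or3P[] /eqP->;
  rewrite ?ste_diag /intertwines ?mulg1 ?mul1g //;
  try by [exact: Cik | exact: Cjk | exact: Cki | exact: Ckj].
- have := intertwinesR (Cik s) (Ckj 1); rewrite ste_comm // mulr1; exact.
- have := intertwinesR (Cjk s) (Cki 1); rewrite ste_comm // mulr1; exact.
Qed.

Lemma dsymb_diagw a b p q c d : 1 + a * b \is a GRing.unit ->
    p \in [:: i; j; k] -> q \in [:: i; j; k] ->
  commute (dsymb i j a b) (diagw p q c d).
Proof.
move=> uD hp hq; rewrite diagw.unlock.
by do !apply: intertwinesM; apply: dsymb_ste.
Qed.

Lemma dsymbC a b p q c d : 1 + a * b \is a GRing.unit ->
    p \in [:: i; j; k] -> q \in [:: i; j; k] ->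
  commute (dsymb i j a b) (dsymb p q c d).
Proof.
move=> uD hp hq; rewrite {2}dsymb.unlock.
by apply: commuteM; last apply: commuteV; apply: dsymb_diagw.
Qed.

(** The cocycle identities of both factors of [dsymb] have the same twist, and
    the twist acts trivially on the symbol by centrality. *)
Lemma dsymb_circ a b c :
    1 + a * b \is a GRing.unit -> 1 + a * c \is a GRing.unit ->
  dsymb i j a (b + c * (1 + a * b)) = (dsymb i j a b * dsymb i j a c)%g.
Proof.
move=> uD uE.
have uD1 : 1 + 1 * (a * b) \is a GRing.unit by rewrite mul1r.
have uE1 : 1 + 1 * (a * c) \is a GRing.unit by rewrite mul1r.
have c1 := diagw_cocycle ij jk ik uD uE.
have := diagw_cocycle ij jk ik uD1 uE1.
rewrite [1 * (a * b)]mul1r.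
rewrite (_ : a * b + _ = a * (b + c * (1 + a * b))); last by ring.
set D := 1 + a * b in uD *; move=> c2.
have DV := mulrV uD.
have D1 : 1 + (D - 1) * 1 = D by ring.
have uD' : 1 + (D - 1) * 1 \is a GRing.unit by rewrite D1.
have uE' : 1 + a / D * (c * D) \is a GRing.unit.
  by rewrite (_ : _ * (_ * D) = a * c) //; ring: DV.
have uE'' : 1 + 1 / D * (a * c * D) \is a GRing.unit.
  by rewrite (_ : _ * (_ * D) = a * c) //; ring: DV.
(* h scales x_ij by D and x_ji by 1/D; it undoes the twist. *)
set h := diagw i k (D - 1) 1.
have hX : (h * (diagw i j (a / D) (c * D) / diagw i j (1 / D) (a * c * D)) =
    dsymb i j a c * h)%g.
  rewrite dsymb.unlock; apply: intertwinesM; last apply: intertwinesV.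
    have := diagw_scale ij jk ik uD' uE'; rewrite D1 mulrK //.
    by rewrite (_ : D * (a / D) = a) //; ring: DV.
  have := diagw_scale ij jk ik uD' uE''; rewrite D1 mulrK //.
  by rewrite (_ : D * (1 / D) = 1) //; ring: DV.
have {hX}X : (diagw i j (a / D) (c * D) / diagw i j (1 / D) (a * c * D) =
    dsymb i j a c)%g.
  apply: (mulgI h); rewrite hX dsymb_diagw // !inE eqxx ?orbT //.
have cH : commute (dsymb i j a c) (diagw i j a b).
  by apply: dsymb_diagw; rewrite // !inE eqxx ?orbT.
rewrite {1}dsymb.unlock c1 c2 invgM mulgA -(mulgA (diagw i j a b)) X.
rewrite -cH -mulgA dsymbC // ?inE ?eqxx ?orbT //.
by congr (_ * _)%g; rewrite dsymb.unlock.
Qed.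

Lemma dsymb1 a : dsymb i j 1 a = 1%g.
Proof. by rewrite dsymb.unlock mul1r mulgV. Qed.

Lemma dsymb0 a : dsymb i j a 0 = 1%g.
Proof.
rewrite dsymb.unlock diagw.unlock !mulr0 !mul0r !oppr0 !ste0 !addr0 !invr1.
by rewrite !mulr1 !mul1g !mulg1 !ste_add !subrr !ste0 mulgV.
Qed.

End ThreeIndices.

(** [diagw_split] for (a, b, c), divided by its instance for (1, 1, abc). *)
Lemma dsymb_split i j k a b c : i != j -> j != k -> i != k ->
    1 + a * b * c \is a GRing.unit ->
  dsymb i j (a * b) c = (dsymb i k a (b * c) * dsymb k j b (c * a))%g.
Proof.
move=> ij jk ik uD; have kj : k != j by rewrite eq_sym.
have ki : k != i by rewrite eq_sym.
have ji : j != i by rewrite eq_sym.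
have u1 : 1 + 1 * 1 * (a * b * c) \is a GRing.unit by rewrite !mul1r.
have := diagw_split ij jk ik u1; rewrite !mulr1 !mul1r => e1.
rewrite {1}dsymb.unlock (diagw_split ij jk ik uD) e1 invgM mulgA.
rewrite -(mulgA (diagw i k a _)) {1}(_ : a * b * c = b * (c * a)); last by ring.
have -> : (diagw k j b (c * a) / diagw k j 1 (b * (c * a)))%g =
    dsymb k j b (c * a) by rewrite dsymb.unlock.
have uD' : 1 + b * (c * a) \is a GRing.unit.
  by rewrite (_ : b * (c * a) = a * b * c) //; ring.
have h : commute (dsymb k j b (c * a)) (diagw i k a (b * c)).
  by apply: (dsymb_diagw kj ji ki); rewrite ?inE ?eqxx ?orbT.
rewrite -h -mulgA -mulrA.
have -> : (diagw i k a (b * c) / diagw i k 1 (a * (b * c)))%g =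
    dsymb i k a (b * c) by rewrite dsymb.unlock.
by rewrite (dsymbC kj ji ki) // !inE eqxx ?orbT.
Qed.

(** [dsymb_split] with one trivial factor: the symbol does not depend on the
    pair of indices. *)
Lemma dsymb_indexl i j k b c : i != j -> j != k -> i != k ->
  1 + b * c \is a GRing.unit -> dsymb i j b c = dsymb k j b c.
Proof.
move=> ij jk ik u; rewrite -[b in LHS]mul1r (@dsymb_split i j k) ?mul1r //.
by rewrite dsymb1 mul1g mulr1.
Qed.

Lemma dsymb_indexr i j k a c : i != j -> j != k -> i != k ->
  1 + a * c \is a GRing.unit -> dsymb i j a c = dsymb i k a c.
Proof.
move=> ij jk ik u; rewrite -[a in LHS]mulr1 (@dsymb_split i j k) ?mulr1 //.
by rewrite dsymb1 mulg1 mul1r.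
Qed.

Lemma dsymb_mull i j k a b c : i != j -> j != k -> i != k ->
    1 + a * b * c \is a GRing.unit ->
  dsymb i j (a * b) c = (dsymb i j a (b * c) * dsymb i j b (c * a))%g.
Proof.
move=> ij jk ik u; rewrite (dsymb_split ij jk ik u).
rewrite (@dsymb_indexr i j k a) // ?mulrA //; rewrite (@dsymb_indexl i j k b) //.
by rewrite (_ : b * (c * a) = a * b * c) //; ring.
Qed.

(** <t^N, x> is the N-th power of <t, t^(N-1) x>; the witness y is given by
    (1 + t^N x)^N = 1 + ty, so that the case N = 0 is covered too. *)
Lemma dsymb_power (t : R) N x : 1 + t ^+ N * x \is a GRing.unit ->
  exists2 y, (1 + t ^+ N * x) ^+ N = 1 + t * y &
             dsymb 0 1 (t ^+ N) x = dsymb 0 1 t y.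
Proof.
elim: N x => [|N IH] x ux.
  by exists 0; rewrite ?expr0 ?mulr0 ?addr0 // dsymb1 dsymb0.
have e : t ^+ N * (x * t) = t ^+ N.+1 * x by rewrite exprS; ring.
have e' : t * (t ^+ N * x) = t ^+ N.+1 * x by rewrite exprS; ring.
have [|y ye de] := IH (x * t); first by rewrite e.
exists (t ^+ N * x + y * (1 + t * (t ^+ N * x))).
  by rewrite exprS -{2}e ye -e'; ring.
rewrite (@dsymb_circ 0 1 2) ?e' // -?ye ?unitrX ?e //.
by rewrite -de exprS (@dsymb_mull 0 1 2) // -exprS.
Qed.

(** For a unit b the lift H(a, b) is conjugate to h_12(D) = H(ab, 1) by a
    diagonal element, and so is H(1, ab) by [diagw1]. Hence <a, b> is a
    commutator of h_12(D) with such an element. As c = -1/b, it is the symbol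
    {D, -b}. *)
Lemma dsymb_st_symb (D c : units R) a b :
    b \is a GRing.unit -> uval D = 1 + a * b -> uval c = - b^-1 ->
  dsymb 0 1 a b = (st_symb D c)^-1%g.
Proof.
move=> ub De ce; have bV := mulrV ub.
have uD : 1 + a * b \is a GRing.unit by rewrite -De uvalP.
have uD1 : 1 + 1 * (a * b) \is a GRing.unit by rewrite mul1r.
have uDl : 1 + a * b * 1 \is a GRing.unit by rewrite mulr1.
have uDr : 1 + - (a * b) * -1 \is a GRing.unit by rewrite mulrNN mulr1.
have cE : 1 + (uval c - 1) * 1 = uval c by ring.
have uc : 1 + (uval c - 1) * 1 \is a GRing.unit by rewrite cE uvalP.
have nE : 1 + (-1 - 1) * 1 = -1 :> R by ring.
have un : 1 + (-1 - 1) * 1 \is a @GRing.unit R by rewrite nE unitrN1.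
have n01 : (0 != 1)%N by []; have n12 : (1 != 2)%N by [].
set h := diagw 0 1 (a * b) 1.
have h12 : @st_h R 0 1 isT (uval D) = h.
  by rewrite (@st_h_diagw _ 0 1 2) ?uvalP // De; congr diagw; ring.
have h13 : @st_h R 0 2 isT (uval c) = diagw 0 2 (uval c - 1) 1.
  by rewrite (@st_h_diagw _ 0 2 1) ?uvalP.
have cV : (uval c)^-1 = - b by rewrite ce invrN invrK.
have Kc : intertwines (diagw 0 2 (uval c - 1) 1) h (diagw 0 1 (- a) (- b)).
  apply: intertwines_eq (diagw_scale n01 n12 isT uc uDl) _.
  by rewrite cE div1r cV ce; congr diagw; ring: bV.
(* Conjugation by -1 is harmless on <a, b> and removes the sign of diagw1. *)
have Kn (x y : R) : 1 + x * y \is a GRing.unit ->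
    intertwines (diagw 0 2 (-1 - 1) 1) (diagw 0 1 x y) (diagw 0 1 (- x) (- y)).
  move=> uxy; apply: intertwines_eq (diagw_scale n01 n12 isT un uxy) _.
  by rewrite nE invrN1 mulN1r mulrN1.
have symbE : (st_symb D c)^-1%g = (diagw 0 1 (- a) (- b) / h)%g.
  apply/(canLR invgK); rewrite invgF /st_symb h12 h13.
  by rewrite -(mulgA h) (intertwinesV Kc) mulgA mulgK.
have Kd : intertwines (diagw 0 2 (-1 - 1) 1) (dsymb 0 1 a b) (st_symb D c)^-1%g.
  rewrite symbE dsymb.unlock; apply: intertwinesM; first exact: Kn.
  apply: intertwinesV; rewrite (@diagw1 _ 0 1 2) -?[1 in X in X -> _]mul1r //.
  by apply: intertwines_eq (Kn _ _ uDr) _; rewrite !opprK.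
apply: (mulIg (diagw 0 2 (-1 - 1) 1)); rewrite -Kd.
exact: (@dsymb_diagw 0 1 2).
Qed.

End Centrality.

(** * Groups of units *)

Lemma uval_inj (R : comUnitRingType) : injective (@uval R).
Proof. exact: val_inj. Qed.

Lemma units_mulACA (R : comUnitRingType) (a b c d : units R) :
  (a * b * (c * d) = a * c * (b * d))%g.
Proof. by rewrite !mulgA -!(mulgA a) (units_mulC b). Qed.

Lemma units_mapM (R S : comUnitRingType) (phi : {rmorphism R -> S}) u v :
  units_map phi (u * v)%g = (units_map phi u * units_map phi v)%g.
Proof. by apply: uval_inj; rewrite /= rmorphM. Qed.

Lemma units_map1 (R S : comUnitRingType) (phi : {rmorphism R -> S}) :
  units_map phi 1%g = 1%g.
Proof. by apply: uval_inj; rewrite /= rmorph1. Qed.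

Section UnitsPowers.
Variable R : comUnitRingType.
Implicit Types (u v : units R) (n m : int).

Lemma uvalM u v : uval (u * v)%g = uval u * uval v. Proof. by []. Qed.
Lemma uvalV u : uval u^-1%g = (uval u)^-1. Proof. by []. Qed.
Lemma uval1 : uval (1%g : units R) = 1. Proof. by []. Qed.

Lemma upow_subproof u n : uval u ^ n \is a GRing.unit.
Proof. by rewrite unitrXz ?uvalP. Qed.
Definition upow u n : units R := Units (upow_subproof u n).

Definition uopp u : units R :=
  @Units _ (- uval u) (eq_trans (unitrN _) (uvalP u)).

Lemma upow0 u : upow u 0 = 1%g.
Proof. exact/val_inj. Qed.

Lemma upow1 u : upow u 1 = u.
Proof. by apply/val_inj; rewrite /= expr1z. Qed.

Lemma upowD u n m : upow u (n + m) = (upow u n * upow u m)%g.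
Proof. by apply/val_inj; rewrite /= exprzDr ?uvalP. Qed.

Lemma upowN u n : upow u (- n) = (upow u n)^-1%g.
Proof. by apply: (mulgI (upow u n)); rewrite -upowD subrr mulgV upow0. Qed.

Lemma upowM u v n : upow (u * v)%g n = (upow u n * upow v n)%g.
Proof. by apply/val_inj; apply: exprMz_comm; rewrite ?uvalP //; exact: mulrC. Qed.

Lemma upow1g n : upow 1%g n = 1%g.
Proof. by apply/val_inj; exact: exp1rz. Qed.

Lemma upow_inv u n : upow u^-1%g n = (upow u n)^-1%g.
Proof. by apply: (mulgI (upow u n)); rewrite -upowM !mulgV upow1g. Qed.

Lemma uoppE u : uopp u = (uopp 1 * u)%g.
Proof. by apply/val_inj; rewrite /= mulN1r. Qed.

(** The sign (-1)^n depends on n modulo 2 only, and n^2 = n modulo 2. *)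
Lemma upow_uopp1_sqr n : upow (uopp 1%g) (n * n) = upow (uopp 1%g : units R) n.
Proof.
have abs m : upow (uopp 1%g : units R) m = upow (uopp 1%g) `|m|%N.
  case: m => // m; rewrite NegzE upowN abszN; apply: (mulgI (upow (uopp 1%g) m.+1)).
  rewrite mulgV; apply/val_inj; rewrite -[RHS]/((-1) ^+ m.+1 * (-1) ^+ m.+1).
  by rewrite -expr2 sqrr_sign.
rewrite abs [RHS]abs abszM; apply/val_inj.
rewrite -[LHS]/((-1) ^+ (`|n| * `|n|)) -[RHS]/((-1) ^+ `|n|).
by rewrite -signr_odd oddM andbb signr_odd.
Qed.

Lemma upow_additive (V : zmodType) (f : units R -> V) :
  {morph f : u v / (u * v)%g >-> u + v} -> forall u n, f (upow u n) = f u *~ n.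
Proof.
move=> fM u; have f1 : f 1%g = 0.
  by apply: (addrI (f 1%g)); rewrite -fM mulg1 addr0.
elim/int_rec => [|n IH|n IH]; first by rewrite upow0 f1.
  by rewrite -[n.+1]addn1 PoszD upowD fM IH upow1 mulrzDr.
rewrite -[n.+1]addn1 PoszD opprD upowD fM IH mulrzDr; congr (_ + _).
by rewrite upowN upow1 mulrNz; apply: (addrI (f u)); rewrite -fM mulgV f1 subrr.
Qed.

(** The tame symbol of u t^n and v t^m, as an element of R^x. *)
Definition tame_unit (u : units R) (n : int) (v : units R) (m : int) : units R :=
  (upow (uopp 1%g) (n * m) * upow u m * upow v (- n))%g.

Lemma tame_unitMl u n u' n' v m :
  tame_unit (u * u')%g (n + n') v m = (tame_unit u n v m * tame_unit u' n' v m)%g.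
Proof.
rewrite /tame_unit mulrDl opprD !upowD upowM.
by apply: uval_inj; rewrite !uvalM; ring.
Qed.

Lemma tame_unitMr u n v m v' m' :
  tame_unit u n (v * v')%g (m + m') = (tame_unit u n v m * tame_unit u n v' m')%g.
Proof.
rewrite /tame_unit mulrDr !upowD !upowM.
by apply: uval_inj; rewrite !uvalM; ring.
Qed.

End UnitsPowers.

Lemma units_mapX (R S : comUnitRingType) (phi : {rmorphism R -> S}) u n :
  units_map phi (upow u n) = upow (units_map phi u) n.
Proof. by apply: uval_inj; apply: rmorphXz; exact: uvalP. Qed.

Lemma units_mapV (R S : comUnitRingType) (phi : {rmorphism R -> S}) u :
  units_map phi u^-1%g = (units_map phi u)^-1%g.
Proof.
by apply: (mulgI (units_map phi u)); rewrite -units_mapM !mulgV units_map1.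
Qed.

Lemma units_map_opp1 (R S : comUnitRingType) (phi : {rmorphism R -> S}) :
  units_map phi (uopp 1%g) = uopp 1%g.
Proof. by apply: uval_inj; rewrite /= rmorphN rmorph1. Qed.

(** * Milnor symbols over a weakly stable ring *)

Section MilnorSymbols.
Variable R : comUnitRingType.
Implicit Types (a b c : units R).

Lemma symbXr a b n : symb a (upow b n) = symb a b *~ n.
Proof. by apply: upow_additive => b' c; exact: symbMr. Qed.

Lemma symbXl a b n : symb (upow a n) b = symb a b *~ n.
Proof.
by apply: (@upow_additive _ _ (fun a => symb a b)) => c a'; exact: symbMl.
Qed.

Lemma symb1l a : symb 1%g a = 0.
Proof. by rewrite -(upow0 1%g) symbXl. Qed.

Lemma symbVr a b : symb a b^-1%g = - symb a b.
Proof. by rewrite -{1}(upow1 b) -upowN symbXr mulrNz. Qed.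

Lemma symbVl a b : symb a^-1%g b = - symb a b.
Proof. by rewrite -{1}(upow1 a) -upowN symbXl mulrNz. Qed.

Lemma weakly_stable5E : weakly_stable R 5 -> forall b0 b1 b2 b3 : R,
  exists2 u, u \is a GRing.unit & [/\ 1 + u * b0 \is a GRing.unit,
    1 + u * b1 \is a GRing.unit, 1 + u * b2 \is a GRing.unit
    & 1 + u * b3 \is a GRing.unit].
Proof.
move=> stR b0 b1 b2 b3.
have [u uu h] := stR (fun i => nth 0 [:: b0; b1; b2; b3] i).
exists u => //; split.
- exact: (h (@Ordinal 4 0 isT)).
- exact: (h (@Ordinal 4 1 isT)).
- exact: (h (@Ordinal 4 2 isT)).
- exact: (h (@Ordinal 4 3 isT)).
Qed.

(** -a = (1 - a) / (1 - 1/a), and both symbols vanish by the Steinberg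
    relation. *)
Lemma symb_opp_stable a : 1 - uval a \is a GRing.unit -> symb a (uopp a) = 0.
Proof.
move=> ua; have aV := mulrV (uvalP a).
have uV : 1 - (uval a)^-1 \is a GRing.unit.
  rewrite (_ : 1 - _ = - (1 - uval a) / uval a); last by ring: aV.
  by rewrite unitrM unitrN ua unitrV uvalP.
have -> : uopp a = (Units ua * (Units uV)^-1)%g.
  apply: (mulIg (Units uV)); rewrite mulgVK; apply/val_inj => /=.
  by ring: aV.
by rewrite symbMr symbVr symb_steinberg // add0r -symbVl symb_steinberg.
Qed.

Lemma symb_oppM a b : symb (a * b)%g (uopp (a * b)%g) =
  symb a (uopp a) + symb b (uopp b) + (symb a b + symb b a).
Proof.
have e1 : uopp (a * b)%g = (uopp a * b)%g by apply/val_inj; rewrite /= mulNr.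
have e2 : uopp (a * b)%g = (uopp b * a)%g.
  by apply/val_inj; rewrite /= mulNr mulrC.
by rewrite symbMl {1}e1 e2 !symbMr addrACA.
Qed.

Hypothesis stR : weakly_stable R 5.

(** Let q(x) = {x, -x} and s(x, y) = {x, y} + {y, x}, so that
    q(xy) = q(x) + q(y) + s(x, y). If 1 - u and 1 - au are units then
    q(u) = q(au) = 0 and q(a) = - s(a, u). Apply this to u, v and uv: as s is
    bilinear, q(a) = 2 q(a). The choice of v imposes four conditions. *)
Lemma symb_opp a : symb a (uopp a) = 0.
Proof.
pose q (x : units R) := symb x (uopp x).
pose s (x y : units R) := symb x y + symb y x.
have qM x y : q (x * y)%g = q x + q y + s x y by exact: symb_oppM.
have good x : 1 - uval x \is a GRing.unit -> q x = 0 by exact: symb_opp_stable.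
have key u : 1 - uval u \is a GRing.unit -> 1 - uval (a * u)%g \is a GRing.unit ->
    q a = - s a u.
  move=> /good qu /good qau; move: (qM a u); rewrite qau qu addr0 => /esym/eqP.
  by rewrite addr_eq0 => /eqP.
have [u uu [u1 u2 _ _]] := weakly_stable5E stR (-1) (- uval a) 0 0.
have [v uv [v1 v2 v3 v4]] :=
  weakly_stable5E stR (-1) (- uval a) (- u) (- (uval a * u)).
rewrite !mulrN ?mulr1 in u1 u2 v1 v2 v3 v4.
pose U := Units uu; pose V := Units uv.
have qU : q a = - s a U by apply: key; rewrite //= mulrC.
have qV : q a = - s a V by apply: key; rewrite //= mulrC.
have qUV : q a = - s a (U * V)%g by apply: key; rewrite /= ?mulrA mulrC.
have sM : s a (U * V)%g = s a U + s a V.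
  by rewrite /s symbMl symbMr addrACA.
rewrite -/(q a); apply: (addrI (q a)); rewrite addr0 {3}qUV sM opprD -qU -qV.
by [].
Qed.

Lemma symbC a b : symb b a = - symb a b.
Proof.
have := symb_oppM a b; rewrite !symb_opp !add0r => /esym/eqP.
by rewrite addrC addr_eq0 => /eqP.
Qed.

Lemma symb_diag a : symb a a = symb (uopp 1%g) a.
Proof.
have e : a = (uopp 1 * uopp a)%g by apply/val_inj; rewrite /= mulrNN mul1r.
rewrite {2}e symbMr symb_opp addr0 symbC -symbVl; congr symb.
by apply/val_inj; rewrite /= invrN invr1.
Qed.

(** The normal form k + {c, t} of a symbol of K_2^M(R_t), for an arbitrary
    unit in place of t. *)
Lemma symb_tame a b c n m :
  symb (a * upow c n)%g (b * upow c m)%g =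
  symb a b + symb (tame_unit a n b m) c.
Proof.
rewrite /tame_unit !symbMl !symbMr !symbXl !symbXr -symb_diag (symbC b c).
rewrite mulNrz mulrNz -mulrzA (mulrC n m) -!addrA; congr (_ + _).
by rewrite [RHS]addrC -addrA.
Qed.

End MilnorSymbols.

(** * Units of the localisation *)

Lemma tofrac_inj (R : idomainType) : injective (@FracField.tofrac R).
Proof. by move=> a b /eqP; rewrite tofrac_eq => /eqP. Qed.

Section UnitsOfLocalisation.
Variables (R : idomainType) (t : R).
Hypothesis prime_t : prime_elt t.
Implicit Types (u v : units R) (n m : int).

Lemma principalP x : reflect (exists y, x = t * y) (x \in principal t).
Proof. exact: asboolP. Qed.

Lemma prime_elt_neq0 : t != 0. Proof. by case: prime_t. Qed.

Lemma prime_elt_unit u : uval u \notin principal t.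
Proof.
case: prime_t => _ [_ n1 _] _; apply: contra n1 => /principalP[y uy].
by apply/principalP; exists (y / uval u); rewrite mulrA -uy mulrV ?uvalP.
Qed.

Lemma prime_elt_nmul u y : uval u <> t * y.
Proof. by move=> uy; case/principalP: (prime_elt_unit u); exists y. Qed.

(** As t is prime, it can be cancelled from one of the factors a and b at each
    step. *)
Lemma dvd_power_unit N a b : a * b = t ^+ N ->
  exists (u : units R) i, a = uval u * t ^+ i.
Proof.
have t0 := prime_elt_neq0.
elim: N a b => [|N IH] a b ab.
  have ua : a \is a GRing.unit by apply/unitrP; exists b; rewrite mulrC ab expr0.
  by exists (Units ua), 0%N; rewrite expr0 mulr1.
have [_ _ pr] := prime_t; have : a * b \in principal t.
  by apply/principalP; exists (t ^+ N); rewrite ab exprS.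
move=> /pr /orP[/principalP[y ay]|/principalP[y bz]].
  have /IH[u [i yE]] : y * b = t ^+ N.
    by apply: (mulfI t0); rewrite mulrA -ay ab exprS.
  by exists u, i.+1; rewrite ay yE exprS mulrCA.
apply: (IH _ y); apply: (mulfI t0).
by rewrite mulrCA -bz ab exprS.
Qed.

(** The ultrametric inequality for u t^a + v t^b = t^k: the smallest of the
    three exponents is attained twice. *)
Lemma unit_sum_power u v a b k :
    uval u * t ^+ a + uval v * t ^+ b = t ^+ k ->
  [\/ exists j, [/\ k = (a + j)%N, b = a & uval u + uval v = t ^+ j],
      exists j, [/\ a = k, b = (k + j)%N & uval u + uval v * t ^+ j = 1]
    | exists j, [/\ b = k, a = (k + j)%N & uval v + uval u * t ^+ j = 1]].
Proof.
have t0 := prime_elt_neq0.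
elim: k a b => [|k IH] [|a] [|b].
- by rewrite !expr0 !mulr1 => e; constructor 2; exists 0%N; rewrite expr0 mulr1.
- by rewrite !expr0 !mulr1 => e; constructor 2; exists b.+1.
- by rewrite !expr0 !mulr1 addrC => e; constructor 3; exists a.+1.
- rewrite !exprS expr0 => e; exfalso; apply: (@prime_elt_nmul 1%g _).
  by rewrite -[uval _]e mulrCA (mulrCA (uval v)) -mulrDr.
- by rewrite !expr0 !mulr1 => e; constructor 1; exists k.+1.
- rewrite expr0 mulr1 !exprS => /(canRL (addrK _)) e; exfalso.
  by apply: (@prime_elt_nmul u); rewrite e (mulrCA (uval v)) -mulrBr.
- rewrite expr0 mulr1 !exprS => /(canRL (addKr _)) e; exfalso.
  by apply: (@prime_elt_nmul v); rewrite e (mulrCA (uval u)) -mulrN -mulrDr.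
rewrite !exprS (mulrCA (uval u)) (mulrCA (uval v)) -mulrDr => /(mulfI t0) /IH.
case=> -[j [e1 e2 e3]]; [constructor 1 | constructor 2 | constructor 3];
  by exists j; rewrite e1 e2.
Qed.

Local Notation tF := (t%:F).
Lemma tF_neq0 : tF != 0. Proof. by rewrite tofrac_eq0 prime_elt_neq0. Qed.

Lemma t_valuation_unit u n : t_valuation t ((uval u)%:F * tF ^ n) = n.
Proof.
have one_n : 1 \notin principal t := prime_elt_unit 1%g.
have notin_mul a b : a \notin principal t -> b \notin principal t ->
    a * b \notin principal t.
  case: prime_t => _ _ pr na nb; apply/negP => /pr.
  by rewrite (negbTE na) (negbTE nb).
have tn0 k : tF ^ k != 0 by rewrite expfz_neq0 // tF_neq0.
have absorb a b d : a \notin principal t -> a%:F = tF ^ d.+1%:Z * b%:F -> False.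
  move=> na e; case/negP: na; apply/principalP; exists (t ^+ d * b).
  by apply: tofrac_inj; rewrite mulrA -exprS rmorphM rmorphXn.
apply: xget_unique => [|y [a [s [na ns e]]]].
  exists (uval u), 1; split=> //; first exact: prime_elt_unit.
  by rewrite rmorph1 divr1 mulrC.
have s0 : s%:F != 0.
  rewrite tofrac_eq0; apply: contraNneq ns => ->.
  by apply/principalP; exists 0; rewrite mulr0.
have {}e : tF ^ n * (uval u * s)%:F = tF ^ y * a%:F.
  by rewrite rmorphM mulrA [tF ^ n * _]mulrC e -mulrA divfK.
have := ltgtP n y; case=> [lt|lt|//].
- have [d yE] : exists d : nat, y = n + d.+1%:Z.
    by exists (absz (y - n)).-1; lia.
  case: (@absorb (uval u * s) a d); first exact: notin_mul (prime_elt_unit u) ns.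
  by apply: (mulfI (tn0 n)); rewrite e yE expfzDr ?tF_neq0 // mulrA.
- have [d nE] : exists d : nat, n = y + d.+1%:Z.
    by exists (absz (n - y)).-1; lia.
  case: (@absorb a (uval u * s) d na).
  by apply: (mulfI (tn0 y)); rewrite -e nE expfzDr ?tF_neq0 // mulrA.
Qed.

Lemma to_away_t_unit : to_away t t \is a GRing.unit.
Proof.
have h : tF^-1 \in away_pred t.
  by apply/away_predP; exists 1, 1%N; rewrite rmorph1 div1r expr1.
apply/unitrPr; exists (MkAway h); apply/val_inj.
by rewrite /= mulfV // tF_neq0.
Qed.

Definition away_t : units (away t) := Units to_away_t_unit.

Definition away_elt u n : units (away t) :=
  (units_map (to_away t) u * upow away_t n)%g.

Lemma awayval_elt u n : awayval (uval (away_elt u n)) = (uval u)%:F * tF ^ n.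
Proof.
by rewrite -[RHS]/(_ * (val (uval away_t)) ^ n) -(rmorphXz _ _ (uvalP away_t)).
Qed.

Lemma awayvalM (x y : away t) : awayval (x * y) = awayval x * awayval y.
Proof. by []. Qed.

Lemma awayval1 : awayval (1 : away t) = 1.
Proof. by []. Qed.

Lemma away_eltP (f : units (away t)) : exists u n, f = away_elt u n.
Proof.
have [a [n fE]] := elimT (away_predP _ _) (awayvalP (uval f)).
have [b [m fV]] := elimT (away_predP _ _) (awayvalP (uval f)^-1).
have ab : a * b = t ^+ (n + m).
  have := congr1 (@awayval R t) (mulrV (uvalP f)).
  rewrite awayvalM awayval1 fE fV => e; apply: tofrac_inj.
  rewrite rmorphM rmorphXn exprD.
  have tn0 k : tF ^+ k != 0 by rewrite expf_neq0 // tF_neq0.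
  by rewrite -[RHS]mul1r -e mulrACA !divfK.
have [u [i aE]] := dvd_power_unit ab.
exists u, (i%:Z - n%:Z); apply/val_inj/val_inj.
rewrite -[RHS]/(awayval _) awayval_elt.
rewrite -[LHS]/(awayval (uval f)) fE aE rmorphM rmorphXn.
by rewrite expfzDr ?tF_neq0 // exprnN mulrA.
Qed.

Lemma away_elt_inj u n v m : away_elt u n = away_elt v m -> u = v /\ n = m.
Proof.
move=> e; have := congr1 (fun x => awayval (uval x)) e.
rewrite !awayval_elt => e'; have nm : n = m.
  by rewrite -(t_valuation_unit u n) e' t_valuation_unit.
split=> //; apply/val_inj/tofrac_inj; move: e'; rewrite nm.
by apply: mulIf; rewrite expfz_neq0 // tF_neq0.
Qed.

End UnitsOfLocalisation.

(** * The pairs that represent zero *)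

Section Extension.
Variables (R : idomainType) (t : R).
Variable F : K2M R -> St R.
(* F is the natural map K_2^M(R) -> K_2(R), composed with K_2(R) -> St(R). *)
Hypothesis FD : {morph F : x y / x + y >-> (x * y)%g}.
Hypothesis F_inj : injective F.
Hypothesis F_symb : forall a b, F (symb a b) = st_symb a b.
Implicit Types (k : K2M R) (c u v w : units R).

(** The pair (k, c) represents k + {c, t}, and {1 + tx, t} corresponds to the
    inverse of <t, x>. *)
Definition tame_rel k c := exists2 x, uval c = 1 + t * x & F k = dsymb 0 1 t x.

Let F0 : F 0 = 1%g.
Proof. by apply: (mulgI (F 0)); rewrite -FD addr0 mulg1. Qed.

Let FN k : F (- k) = (F k)^-1%g.
Proof. by apply: (mulgI (F k)); rewrite -FD subrr F0 mulgV. Qed.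

Lemma tame_rel0 : tame_rel 0 1%g.
Proof. by exists 0; rewrite ?mulr0 ?addr0 // F0 dsymb0. Qed.

Lemma tame_relM k c k' c' :
  tame_rel k c -> tame_rel k' c' -> tame_rel (k + k') (c * c')%g.
Proof.
move=> [x cx Fx] [x' cx' Fx']; have uc := uvalP c; have uc' := uvalP c'.
exists (x + x' * (1 + t * x)); first by rewrite uvalM cx cx'; ring.
by rewrite FD Fx Fx' (@dsymb_circ _ 0 1 2) // -?cx -?cx'.
Qed.

Lemma tame_relV k c : tame_rel k c -> tame_rel (- k) c^-1%g.
Proof.
move=> [x cx Fx]; have uc := uvalP c; pose x' := - x / uval c.
have cV := mulrV uc; have cVe : 1 + t * x' = (uval c)^-1.
  have tx : t * x = uval c - 1 by rewrite cx; ring.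
  apply: (mulrI uc); rewrite cV /x'.
  have -> : uval c * (1 + t * (- x / uval c)) =
            uval c - t * x * (uval c / uval c) by ring.
  by rewrite cV tx; ring.
exists x'; first by rewrite cVe.
have : dsymb 0 1 t (x + x' * (1 + t * x)) = (dsymb 0 1 t x * dsymb 0 1 t x')%g.
  by apply: (@dsymb_circ _ 0 1 2) => //; rewrite -?cx ?cVe ?unitrV.
rewrite -cx /x' divrK // subrr dsymb0 -Fx => /esym e.
by rewrite FN; apply: mulg1_eq.
Qed.

(** The pairs with c = 1 are trivial. In the end this is the injectivity of
    K_2^M(R) -> K_2^M(R_t). *)
Lemma tame_rel1 k : t != 0 -> tame_rel k 1%g -> k = 0.
Proof.
move=> t_neq0 [x /eqP]; rewrite uval1 -{1}[1]addr0 (inj_eq (addrI _)) eq_sym.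
rewrite mulf_eq0 (negbTE t_neq0) /= => /eqP->; rewrite dsymb0 -F0.
exact: F_inj.
Qed.

Lemma tame_rel_one_plus k c : tame_rel k c -> c \in one_plus t.
Proof. by case=> x cx _; apply/one_plusP; exists x. Qed.

(** The basic Steinberg relation {1 + t^N w, -t^N w} = 0 of R_t. *)
Lemma tame_rel_steinberg N v w : uval v = 1 + t ^+ N * uval w ->
  tame_rel (symb v (uopp w)) (upow v N).
Proof.
move=> ve; have uv := uvalP v; rewrite ve in uv.
have [y ye de] := dsymb_power uv.
exists y; first by rewrite -ye -ve.
rewrite -de (dsymb_st_symb (c := (uopp w)^-1%g) (uvalP w) ve) ?uvalV ?invrN //.
by rewrite -F_symb symbVr FN invgK.
Qed.

Hypothesis stR : weakly_stable R 5.

(** The three cases of [unit_sum_power] are u + v = t^j, u + v t^j = 1 and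
    v + u t^j = 1. The last two are instances of [tame_rel_steinberg]; so is the
    first one after division by u, which reads -v/u = 1 + t^j (-1/u). *)
Lemma tame_unit_steinberg u v (a b k : nat) :
    uval u * t ^+ a + uval v * t ^+ b = t ^+ k -> prime_elt t ->
  tame_rel (symb u v) (tame_unit u (a%:Z - k%:Z) v (b%:Z - k%:Z)).
Proof.
move=> e prime_t.
case: (unit_sum_power prime_t e) => -[j [-> -> {}e]].
- have -> : a%:Z - (a + j)%N%:Z = - j%:Z by lia.
  pose x := uopp u^-1%g; pose v' := (v * x)%g.
  have ve : uval v' = 1 + t ^+ j * uval x.
    by rewrite /v' uvalM /x /= -e; have := mulrV (uvalP u) => uV; ring: uV.
  have -> : tame_unit u (- j%:Z) v (- j%:Z) = upow v' j.
    rewrite /tame_unit mulrNN upow_uopp1_sqr opprK upowN /v' /x.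
    by rewrite (uoppE u^-1%g) !upowM upow_inv [RHS]units_mulC.
  suff -> : symb u v = symb v' (uopp x) by exact: tame_rel_steinberg.
  rewrite /v' symbMl symb_opp // addr0 symbC //.
  by rewrite -symbVr; congr symb; apply/val_inj; rewrite /= opprK.
- rewrite (_ : (k + j)%N%:Z - k%:Z = j%:Z) ?subrr; last by lia.
  rewrite /tame_unit mul0r oppr0 !upow0 mul1g mulg1.
  have -> : v = uopp (uopp v) by apply/val_inj; rewrite /= opprK.
  by apply: tame_rel_steinberg; rewrite -e /=; ring.
- rewrite (_ : (k + j)%N%:Z - k%:Z = j%:Z) ?subrr; last by lia.
  rewrite /tame_unit mulr0 !upow0 !mul1g symbC // upowN; apply: tame_relV.
  have -> : u = uopp (uopp u) by apply/val_inj; rewrite /= opprK.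
  by apply: tame_rel_steinberg; rewrite -e /=; ring.
Qed.

End Extension.

(** * Evaluation of words in the symbols of the localisation *)

Section Decomposition.
Variables (R : idomainType) (t : R).
Hypothesis prime_t : prime_elt t.
Implicit Types (u v : units R) (n m : int) (f g h : units (away t)).

Local Notation elt := (away_elt prime_t).

Lemma away_elt_pair f : exists p : units R * int, f = elt p.1 p.2.
Proof. by have [u [n ->]] := away_eltP prime_t f; exists (u, n). Qed.

Definition unit_part f : units R := (projT1 (cid (away_elt_pair f))).1.
Definition val_part f : int := (projT1 (cid (away_elt_pair f))).2.

Lemma away_partE f : f = elt (unit_part f) (val_part f).
Proof. exact: (projT2 (cid (away_elt_pair f))). Qed.

Lemma unit_part_elt u n : unit_part (elt u n) = u.
Proof. by have /esym/away_elt_inj[] := away_partE (elt u n). Qed.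

Lemma val_part_elt u n : val_part (elt u n) = n.
Proof. by have /esym/away_elt_inj[] := away_partE (elt u n). Qed.

Lemma away_eltM u n v m : (elt u n * elt v m)%g = elt (u * v)%g (n + m).
Proof. by rewrite /away_elt units_mapM upowD units_mulACA. Qed.

Lemma unit_partM f g : unit_part (f * g)%g = (unit_part f * unit_part g)%g.
Proof.
by rewrite {1}(away_partE f) {1}(away_partE g) away_eltM unit_part_elt.
Qed.

Lemma val_partM f g : val_part (f * g)%g = val_part f + val_part g.
Proof.
by rewrite {1}(away_partE f) {1}(away_partE g) away_eltM val_part_elt.
Qed.

Lemma away_elt0 u : elt u 0 = units_map (to_away t) u.
Proof. by rewrite /away_elt upow0 mulg1. Qed.

Lemma away_elt1 : elt 1%g 1 = away_t prime_t.
Proof. by rewrite /away_elt upow1 units_map1 mul1g. Qed.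

(** The coordinate c of {f, g} = k + {c, t}; see [tame_symbolE]. *)
Definition symbol_val f g : units R :=
  tame_unit (unit_part f) (val_part f) (unit_part g) (val_part g).

Lemma tame_symbolE f g :
  (uval (symbol_val f g))%:F =
  tame_symbol t (awayval (uval f)) (awayval (uval g)).
Proof.
rewrite /tame_symbol {2 3 4}(away_partE f) {2 3 4}(away_partE g) !awayval_elt.
rewrite !(t_valuation_unit prime_t) /symbol_val.
move: (unit_part f) (val_part f) (unit_part g) (val_part g).
move=> u n v m.
have pF (w : units R) k : (uval (upow w k))%:F = (uval w)%:F ^ k.
  by rewrite -(rmorphXz (@FracField.tofrac R)) ?uvalP.
have tF0 := tF_neq0 prime_t.
transitivity ((uval (uopp (1%g : units R)))%:F ^ (n * m) * (uval u)%:F ^ m *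
              (uval v)%:F ^ (- n)).
  by rewrite -!pF /tame_unit !uvalM !rmorphM.
have -> : (uval (uopp (1%g : units R)))%:F = -1 by rewrite rmorphN rmorph1.
have e : t%:F ^ (n * m) * t%:F ^ (m * - n) = 1.
  by rewrite -expfzDr // (_ : n * m + m * - n = 0) ?expr0z //; ring.
by rewrite !expfzMl !exprz_exp; ring: e.
Qed.

Section Words.
Local Notation gens := (units (away t) * units (away t))%type.

Definition word_symb (w : word gens) : K2M R :=
  \sum_(p <- w) (if p.2 then symb (unit_part p.1.1) (unit_part p.1.2)
                 else - symb (unit_part p.1.1) (unit_part p.1.2)).

Definition word_val (w : word gens) : units R :=
  (\prod_(p <- w) (if p.2 then symbol_val p.1.1 p.1.2
                   else (symbol_val p.1.1 p.1.2)^-1))%g.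

Lemma word_symb_cat w w' : word_symb (w ++ w') = word_symb w + word_symb w'.
Proof. exact: big_cat. Qed.

Lemma word_val_cat w w' : word_val (w ++ w') = (word_val w * word_val w')%g.
Proof. exact: big_cat. Qed.

Variable F : K2M R -> St R.
Hypothesis FD : {morph F : x y / x + y >-> (x * y)%g}.
Hypothesis F_inj : injective F.
Hypothesis F_symb : forall a b, F (symb a b) = st_symb a b.
Hypothesis stR : weakly_stable R 5.

Let rel := @tame_rel R t F.

(** Clear denominators in f + g = 1 to reach [tame_unit_steinberg]. *)
Lemma away_steinberg f g : uval g = 1 - uval f ->
  rel (symb (unit_part f) (unit_part g)) (symbol_val f g).
Proof.
move=> fg; have := awayval_elt prime_t (unit_part g) (val_part g).
have := awayval_elt prime_t (unit_part f) (val_part f).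
rewrite -!away_partE fg /symbol_val.
move: (unit_part f) (val_part f) (unit_part g) (val_part g) => u n v m fE gE.
have {fE gE} e : (uval u)%:F * t%:F ^ n + (uval v)%:F * t%:F ^ m = 1.
  by rewrite -fE -gE -[awayval (1 - _)]/(1 - awayval (uval f)) addrC subrK.
pose k := (`|n| + `|m|)%N.
pose a := `|(n + k%:Z)%R|%N; pose b := `|(m + k%:Z)%R|%N.
have aE : a%:Z = n + k%:Z by rewrite /a /k; lia.
have bE : b%:Z = m + k%:Z by rewrite /b /k; lia.
have -> : n = a%:Z - k%:Z by rewrite aE addrK.
have -> : m = b%:Z - k%:Z by rewrite bE addrK.
apply: tame_unit_steinberg => //; apply: tofrac_inj.
have tF0 := tF_neq0 prime_t.
have powE (j : nat) l : j%:Z = l -> (t ^+ j)%:F = t%:F ^ l.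
  by move=> <-; rewrite tofracXn.
rewrite tofracD !tofracM (powE _ _ aE) (powE _ _ bE) (powE _ _ (erefl k%:Z)).
by rewrite !expfzDr // !mulrA -mulrDl e mul1r.
Qed.

(** Bilinearity and commutativity hold exactly for the pairs; only the
    Steinberg relation needs the quotient by [tame_rel]. *)
Lemma word_cong_tame w w' : word_cong (@K2M_rel (away t)) w w' ->
  rel (word_symb w - word_symb w') (word_val w / word_val w')%g.
Proof.
have r0 k c : k = 0 -> c = 1%g -> rel k c by move=> -> ->; exact: tame_rel0.
elim=> {w w'} [w|w w' _ IH|w w' w'' _ IH _ IH'|w1 w1' w2 w2' _ IH1 _ IH2
              |x b|w w'].
- by apply: r0; rewrite ?subrr ?mulgV.
- by have := tame_relV FD IH; rewrite opprB invgF.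
- by have := tame_relM FD IH IH'; rewrite addrA subrK mulgA mulgVK.
- have := tame_relM FD IH1 IH2; rewrite !word_symb_cat !word_val_cat.
  rewrite addrACA -opprD units_mulACA; congr (rel _ (_ * _)%g).
  by rewrite invgM units_mulC.
- rewrite /word_symb /word_val !big_cons !big_nil /=.
  by case: b; apply: r0;
    rewrite /= ?(subr0, addr0, invg1, mulg1, subrr, addNr, mulgV, mulVg).
case=> [f g h|f g h|f g fg|p q];
  rewrite /word_symb /word_val !big_cons !big_nil /=.
- apply: r0; rewrite ?addr0 ?mulg1 ?unit_partM.
    by rewrite symbMr subrr.
  by rewrite /symbol_val unit_partM val_partM tame_unitMr mulgV.
- apply: r0; rewrite ?addr0 ?mulg1 ?unit_partM.
    by rewrite symbMl subrr.
  by rewrite /symbol_val unit_partM val_partM tame_unitMl mulgV.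
- by rewrite addr0 subr0 mulg1 divg1; exact: away_steinberg.
- apply: r0; rewrite ?addr0 ?mulg1; first by rewrite [X in X - _]addrC subrr.
  by rewrite [X in (X / _)%g]units_mulC mulgV.
Qed.

End Words.

End Decomposition.

(** * The exact sequence *)

(** The class of a word, typed in [K2M] so that it is written additively. *)
Definition K2M_of_word (S : comUnitRingType)
  (w : word (units S * units S)%type) : K2M S := \pi w.

Lemma K2M_of_word_repr (S : comUnitRingType) (x : K2M S) :
  K2M_of_word (repr x) = x.
Proof. exact: (@reprK _ (presented (@K2M_rel S))). Qed.

Lemma K2M_of_wordP (S : comUnitRingType)
    (w w' : word (units S * units S)%type) :
  K2M_of_word w = K2M_of_word w' -> word_cong (@K2M_rel S) w w'.
Proof. by move=> /presented_eqP. Qed.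

Lemma K2M_of_word_nil (S : comUnitRingType) : K2M_of_word [::] = 0 :> K2M S.
Proof. exact: pi_presented_one. Qed.

Lemma K2M_of_word_cat (S : comUnitRingType)
    (w w' : word (units S * units S)%type) :
  K2M_of_word (w ++ w') = K2M_of_word w + K2M_of_word w'.
Proof. exact: pi_presented_mul. Qed.

Lemma K2M_of_word_cons (S : comUnitRingType) (p : units S * units S) b w :
  K2M_of_word ((p, b) :: w) =
  (if b then symb p.1 p.2 else - symb p.1 p.2) + K2M_of_word w.
Proof.
rewrite -cat1s K2M_of_word_cat; congr (_ + _).
by case: b; case: p => f g //; rewrite /K2M_of_word -[RHS]pi_presented_inv.
Qed.

Section K2MMapAdditive.
Variables (R S : comUnitRingType) (phi : {rmorphism R -> S}).

Lemma K2M_map0 : K2M_map phi 0 = 0. Proof. exact: raddf0. Qed.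
Lemma K2M_mapD x y : K2M_map phi (x + y) = K2M_map phi x + K2M_map phi y.
Proof. exact: raddfD. Qed.
Lemma K2M_mapN x : K2M_map phi (- x) = - K2M_map phi x.
Proof. exact: raddfN. Qed.
Lemma K2M_mapB x y : K2M_map phi (x - y) = K2M_map phi x - K2M_map phi y.
Proof. exact: raddfB. Qed.

End K2MMapAdditive.

Section Main.
Variables (R : idomainType) (t : R).
Hypothesis prime_t : prime_elt t.
Hypothesis stR : weakly_stable R 5.
Local Notation K2Mt := (K2M_map (to_away t)).
Local Notation tt := (away_t prime_t).
Local Notation elt := (away_elt prime_t).
Local Notation wsymb := (word_symb prime_t).
Local Notation wval := (word_val prime_t).
Implicit Types (u v : units R) (n m : int) (f g : units (away t)).

(** Over a common denominator t^N the elements b_i become a_i / t^N. If u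
    solves the problem for the a_i in R, then t^N u solves it for the b_i. *)
Lemma away_weakly_stable d : weakly_stable R d -> weakly_stable (away t) d.
Proof.
move=> stRd b; have tF0 := tF_neq0 prime_t.
have /choice[p bE] : forall i, exists p : R * nat,
    awayval (b i) = p.1%:F / t%:F ^+ p.2.
  by move=> i; have /away_predP[a [n e]] := awayvalP (b i); exists (a, n).
pose N := (\sum_i (p i).2)%N.
have [u uu hu] := stRd (fun i => (p i).1 * t ^+ (N - (p i).2)).
pose v := elt (Units uu) N.
exists (uval v); first exact: uvalP.
move=> i; rewrite [X in X \is a _](_ : _ =
    to_away t (1 + u * ((p i).1 * t ^+ (N - (p i).2)))).
  exact: rmorph_unit (hu i).
apply: val_inj; rewrite -[LHS]/(1 + awayval (uval v) * awayval (b i)).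
rewrite awayval_elt bE -[RHS]/(FracField.tofrac _).
rewrite tofracD tofrac1 !tofracM tofracXn.
have le_iN : ((p i).2 <= N)%N by rewrite /N (bigD1 i) //= leq_addr.
rewrite -exprnP -{1}(subnK le_iN) exprD; congr (_ + _).
have : t%:F ^+ (p i).2 / t%:F ^+ (p i).2 = 1 by rewrite mulfV // expf_neq0.
by rewrite /=; move: (_ ^- _) => x e; ring: e.
Qed.

Let stT : weakly_stable (away t) 5. Proof. exact: away_weakly_stable. Qed.

Lemma symb_elt u n v m : symb (elt u n) (elt v m) =
  K2Mt (symb u v) + symb (units_map (to_away t) (tame_unit u n v m)) tt.
Proof.
rewrite /away_elt symb_tame // K2M_map_symb /tame_unit.
by rewrite !units_mapM !units_mapX units_map_opp1.
Qed.

Lemma K2M_of_word_decomp w : K2M_of_word w =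
  K2Mt (wsymb w) + symb (units_map (to_away t) (wval w)) tt.
Proof.
elim: w => [|[[f g] b] w IH].
  rewrite K2M_of_word_nil /word_symb /word_val !big_nil K2M_map0 units_map1.
  by rewrite symb1l addr0.
have fgE := symb_elt (unit_part prime_t f) (val_part prime_t f)
                     (unit_part prime_t g) (val_part prime_t g).
rewrite -!away_partE in fgE.
rewrite K2M_of_word_cons IH /word_symb /word_val !big_cons K2M_mapD units_mapM symbMl.
rewrite addrACA; congr (_ + _); case: b => //=.
by rewrite fgE opprD K2M_mapN units_mapV symbVl.
Qed.

Lemma K2M_map_word y : exists w,
  [/\ K2M_of_word w = K2Mt y, wsymb w = y & wval w = 1%g].
Proof.
rewrite -(K2M_of_word_repr y); elim: (repr y) => [|[[u v] b] w0 [w [e1 e2 e3]]].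
  by exists [::]; rewrite !K2M_of_word_nil K2M_map0 /word_symb /word_val !big_nil.
exists (((units_map (to_away t) u, units_map (to_away t) v), b) :: w).
rewrite !K2M_of_word_cons e1 K2M_mapD /= /word_symb /word_val !big_cons.
rewrite -/(wsymb w) -/(wval w) e2 e3 /symbol_val -!(away_elt0 prime_t).
rewrite !unit_part_elt !val_part_elt !away_elt0 mulg1; split.
- by case: b; rewrite ?K2M_mapN K2M_map_symb.
- by [].
rewrite /tame_unit mulr0 oppr0 !upow0 !mulg1.
by case: b => //; rewrite invg1.
Qed.

(** On generators, {1 + tw, t} = - {1 + tw, -w} as {1 + tw, -tw} = 0. *)
Lemma one_plus_symb_t c : generated (one_plus_unit t) =i one_plus t ->
  c \in one_plus t -> exists y, K2Mt y = symb (units_map (to_away t) c) tt.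
Proof.
move=> gen; rewrite -gen => /asboolP genc.
pose H := [pred c | `[< exists y, K2Mt y = symb (units_map (to_away t) c) tt >]].
have /asboolP// : c \in H; apply: genc.
- split; first by apply/asboolP; exists 0; rewrite K2M_map0 units_map1 symb1l.
  move=> x y /asboolP[kx hx] /asboolP[ky hy]; apply/asboolP; exists (kx - ky).
  by rewrite K2M_mapB hx hy units_mapM units_mapV symbMl symbVl.
move=> v /asboolP[w ve]; apply/asboolP; exists (- symb v (uopp w)).
rewrite K2M_mapN K2M_map_symb; apply/eqP; rewrite eq_sym -addr_eq0 -symbMr; apply/eqP.
apply: symb_steinberg; rewrite uvalM /= ve.
by apply: val_inj; rewrite /= !rmorphN !rmorphD !rmorphM /= rmorph1; ring.
Qed.

End Main.

Lemma units_classM (R : comUnitRingType) (t : R) (u v : units R) :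
  units_class t (u * v)%g = (units_class t u * units_class t v)%g.
Proof. exact: pi_units_mod_mul. Qed.

Lemma units_class_eq (R : comUnitRingType) (t : R) (u v : units R) :
  units_class t u = units_class t v <-> (u / v)%g \in one_plus t.
Proof. by split=> [/eqmodP|uv]; last apply/eqmodP. Qed.

Lemma units_class1 (R : comUnitRingType) (t : R) (u : units R) :
  units_class t u = 1%g <-> u \in one_plus t.
Proof.
have e1 : units_class t 1%g = 1%g.
  by apply: (mulgI (units_class t 1%g)); rewrite -units_classM !mulg1.
by rewrite -e1 units_class_eq divg1.
Qed.

Theorem corollary4p3 (R : idomainType) (t : R)
    (noethR : noetherian R) (prime_t : prime_elt t)
    (A1 : forall x : {fraction R},
      (x \in away_pred t /\ x \in localised_pred t) <-> exists a : R, x = a%:F)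
    (A2_stable : weakly_stable R 5)
    (A2_iso : exists2 f : K2M R -> K2 R, natural_K2_map f & bijective f)
    (A3 : generated (one_plus_unit t) =i one_plus t) :
  injective (K2M_map (to_away t)) /\
  exists cbar : K2M (away t) -> units_mod t,
    [/\ {morph cbar : x y / x + y >-> (x * y)%g},
        (forall f g : units (away t),
          exists2 c : units R,
            (uval c)%:F =
              tame_symbol t (awayval (uval f)) (awayval (uval g))
            & cbar (symb f g) = units_class t c),
        (forall x, cbar x = 1%g <-> exists y, K2M_map (to_away t) y = x)
      & (forall z, exists x, cbar x = z)].
Proof.
have t_neq0 := prime_elt_neq0 prime_t.
have [F [FD F_inj F_symb]] : exists F : K2M R -> St R,
    [/\ {morph F : x y / x + y >-> (x * y)%g}, injective F
      & forall a b, F (symb a b) = st_symb a b].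
  have [f [fD f_symb] f_bij] := A2_iso.
  exists (fun k => K2val (f k)); split=> // [x y|x y /val_inj].
    by rewrite fD.
  exact: bij_inj.
pose val (x : K2M (away t)) := word_val prime_t (repr x).
have rel_word w w' : K2M_of_word w = K2M_of_word w' ->
    tame_rel t F (word_symb prime_t w - word_symb prime_t w')
                 (word_val prime_t w / word_val prime_t w')%g.
  by move=> /K2M_of_wordP; exact: word_cong_tame.
have val_word w x : K2M_of_word w = x ->
    units_class t (val x) = units_class t (word_val prime_t w).
  move=> wx; apply/units_class_eq/(tame_rel_one_plus (F := F)).
  by apply: rel_word; rewrite K2M_of_word_repr wx.
have symb_word (f g : units (away t)) : K2M_of_word [:: ((f, g), true)] = symb f g.
  by rewrite K2M_of_word_cons K2M_of_word_nil addr0.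
have val_symb (f g : units (away t)) :
    units_class t (val (symb f g)) = units_class t (symbol_val prime_t f g).
  by rewrite (val_word _ _ (symb_word f g)) /word_val big_cons big_nil mulg1.
split.
  (* A word for the image of y has the pair (y, 1); if that image is 0, then so
     is y. *)
  apply: raddf_inj => y y0; have [w [wy ws wv]] := K2M_map_word prime_t y.
  have := rel_word w [::]; rewrite wy y0 K2M_of_word_nil => /(_ erefl).
  rewrite ws wv /word_symb /word_val !big_nil subr0 mulgV.
  exact: tame_rel1.
exists (fun x => units_class t (val x)); split.
- move=> x y; rewrite -units_classM -word_val_cat; apply: val_word.
  by rewrite K2M_of_word_cat !K2M_of_word_repr.
- move=> f g; exists (symbol_val prime_t f g); last exact: val_symb.
  exact: tame_symbolE.
- move=> x; split=> [/units_class1 /(one_plus_symb_t prime_t A3)[y ye]|[y <-]].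
    exists (word_symb prime_t (repr x) + y).
    by rewrite K2M_mapD ye -K2M_of_word_decomp // K2M_of_word_repr.
  have [w [wy _ wv]] := K2M_map_word prime_t y.
  by rewrite (val_word _ _ wy) wv; apply/units_class1; case: (one_plus_group_closed t).
move=> z; have [u <-] : exists u, units_class t u = z.
  by exists (repr z); exact: reprK.
exists (symb (units_map (to_away t) u) (away_t prime_t)); rewrite val_symb.
rewrite -(away_elt0 prime_t) -away_elt1 /symbol_val !unit_part_elt !val_part_elt.
by rewrite /tame_unit mul0r oppr0 !upow0 upow1 mul1g mulg1.
Qed.
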